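(* For every $d\in\mathbb{N}$ there is a number $C(d)$, depending only on $d$, such that the following holds for every $n\in\mathbb{N}$. Let $Z$ be the standard $n$-dimensional normal random vector. Let $g(x)=\langle Bx,x\rangle+\langle b,x\rangle+\beta$, $x\in\mathbb{R}^n$, where $B$ is a self-adjoint linear operator on $\mathbb{R}^n$, $b\in\mathbb{R}^n$, $\beta\in\mathbb{R}$, and suppose that $B$ has at least three nonzero eigenvalues counted with multiplicity, i.e. the cardinality of $\{\lambda\in\Lambda(B)\colon\lambda\neq 0\}$ is at least three. Let $f$ be any polynomial of degree at most $d$ on $\mathbb{R}^n$. Then $$ d_{\rm TV}\bigl(f(Z),g(Z)\bigr)\le\frac{C(d)}{\sqrt{|s_1|\cdot|s_2|}}\,\|f(Z)-g(Z)\|_2, $$ where $s_1$ and $s_2$ are any two eigenvalues from $\Lambda(B)$ (counted with multiplicity) of the same sign (both positive or both negative). When $f$ is of degree at most $2$, one can take $C(2)=80$, i.e. the bound holds with constant $80$. In particular, if the eigenvalues in $\Lambda(B)$ are enumerated, counting multiplicities, so that $|\lambda_1|\ge|\lambda_2|\ge|\lambda_3|\ge\dots$, then $$ d_{\rm TV}\bigl(f(Z),g(Z)\bigr)\le\frac{C(d)}{\sqrt{|\lambda_2|\cdot|\lambda_3|}}\,\|f(Z)-g(Z)\|_2, $$ and when $f$ is of degree at most $2$ one can take $C(2)=80$ here as well.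
   Context: The standard normal random vector $Z=(Z_1,\dots,Z_n)$ in $\mathbb{R}^n$ has i.i.d. components with distribution $\mathcal{N}(0,1)$. Polynomials are real-valued with real coefficients; $\langle\cdot,\cdot\rangle$ is the Euclidean inner product. For real random variables $\xi,\eta$, $$d_{\rm TV}(\xi,\eta):=\sup\bigl\{\mathbb{E}[\varphi(\xi)]-\mathbb{E}[\varphi(\eta)]\colon \varphi\in C_0^\infty(\mathbb{R}),\ \|\varphi\|_\infty\le1\bigr\},$$ where $\|\varphi\|_\infty=\sup_{t\in\mathbb{R}}|\varphi(t)|$ and $C_0^\infty(\mathbb{R})$ is the space of smooth compactly supported functions. For a random variable $\xi$, $\|\xi\|_2:=(\mathbb{E}|\xi|^2)^{1/2}$. For a self-adjoint operator $B$, $\Lambda(B)$ denotes the set of all its eigenvalues, counting multiplicities (a multiset). *)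

(* Defs.v *)
From HB Require Import structures.
From mathcomp Require Import all_boot all_order all_algebra.
From mathcomp Require Import polyrcf.
From mathcomp Require Import all_classical all_reals all_analysis.

Set Implicit Arguments.
Unset Strict Implicit.
Unset Printing Implicit Defensive.
Import Order.TTheory GRing.Theory Num.Theory.
Import numFieldNormedType.Exports.

Local Open Scope classical_set_scope.
Local Open Scope ring_scope.

Section linear_algebra.
Context {R : realType} {n : nat}.
Implicit Types (B : 'M[R]_n) (x y b : 'cV[R]_n).

Definition dotp x y : R := \sum_(i < n) x i 0 * y i 0.

(* A linear operator on R^n is given by its matrix, acting by x |-> B *m x. *)
Definition self_adjoint B : Prop :=
  forall x y, dotp (B *m x) y = dotp x (B *m y).

(* [eigenspace] consists of row vectors [v] with [v *m A = a *: v]; for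
   [A := B^T] these are the transposes of the eigenvectors of x |-> B *m x. *)
Definition eigmult B (a : R) : nat := \rank (eigenspace B^T a).

(* The multiset Lambda(B), represented by a list (its order is irrelevant);
   [rootsR] enumerates the distinct real roots. *)
Definition eigvals B : seq R :=
  flatten [seq nseq (eigmult B a) a | a <- rootsR (char_poly B)].

Definition quadfun B b (beta : R) x : R := dotp (B *m x) x + dotp b x + beta.

End linear_algebra.

Definition same_sign {R : realType} (s1 s2 : R) : Prop :=
  (0 < s1 /\ 0 < s2) \/ (s1 < 0 /\ s2 < 0).

Section random_variables.
Context {disp : measure_display} {T : measurableType disp} {R : realType}.
Variable P : probability T R.

Definition mutually_independent (n : nat) (Z : 'I_n -> {RV P >-> R}) : Prop :=
  forall (J : {set 'I_n}) (A : 'I_n -> set R),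
    (forall i, i \in J -> measurable (A i)) ->
    (P (\bigcap_(i in [set` J]) (Z i @^-1` A i)) =
     \prod_(i in J) P (Z i @^-1` A i))%E.

Definition standard_normal_vector (n : nat) (Z : 'I_n -> {RV P >-> R}) : Prop :=
  (forall i (A : set R), measurable A ->
     distribution P (Z i) A = normal_prob 0 1 A) /\
  mutually_independent Z.

(* C_0^oo(R); all iterated derivatives are required to be genuine ones, since
   [derive1] is total. *)
Definition smooth_compactly_supported (phi : R -> R) : Prop :=
  (forall (k : nat) (t : R), derivable (derive1n k phi) t 1) /\
  compact (closure [set t | phi t != 0]).

Definition supnorm (phi : R -> R) : \bar R :=
  ereal_sup (range (fun t => `|phi t|%:E)).

Definition dTV (xi eta : T -> R) : \bar R :=
  ereal_sup [set ('E_P[phi \o xi] - 'E_P[phi \o eta])%E | phi in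
    [set phi | smooth_compactly_supported phi /\ (supnorm phi <= 1)%E]].

Definition L2norm (xi : T -> R) : \bar R := 'N[P]_(2%:E)[EFin \o xi]%E.

End random_variables.

Arguments dTV {disp T R} P xi eta.
Arguments L2norm {disp T R} P xi.
Arguments standard_normal_vector {disp T R} P {n} Z.

(* Main.v *)
Require Import Defs.
From HB Require Import structures.
From mathcomp Require Import all_boot all_order all_algebra.
From mathcomp Require Import polyrcf.
From mathcomp Require Import -(notations) mpoly.
From mathcomp Require Import all_classical all_reals all_analysis.
From mathcomp Require Import measurable_realfun ring lra.
Import Order.TTheory GRing.Theory Num.Theory.
Import numFieldNormedType.Exports.

Set Implicit Arguments.
Unset Strict Implicit.
Local Open Scope classical_set_scope.
Local Open Scope ring_scope.

(** Why the theorem is true.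

    Let [h = f - g], let [phi] be a continuous test function bounded by 1 and [F] an
    antiderivative of [phi], so that [F] is 1-Lipschitz.  Choose orthonormal
    eigenvectors [v], [u] of [B] for the two eigenvalues [s1], [s2] of the same sign,
    say positive.  With [a = sqrt s1], [b = sqrt s2], the derivatives of the quadratic
    function [g] along [v] and [u] are [2 a Y] and [2 b U], where [Y = a x_v + c] and
    [U = b x_u + e] are affine functions of one coordinate each.

    In the plane with coordinates [Y], [U] consider the field with components
    [V = Y / (2 a r)] along [v] and [V' = U / (2 b r)] along [u], where
    [r = Y^2 + U^2].  The derivative of [g] along it is 1 and away from the origin it
    is divergence free, because [(Y, U) / r] is.  Hence, for [K = F(f) - F(g)],
      [phi(f) - phi(g) = V D_v K + V' D_u K - phi(f) (V D_v h + V' D_u h)],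
    and Gaussian integration by parts ([stein]) moves the derivatives of [K] onto the
    field and the density.  As [|K| <= |h|], the difference of the two expectations is
    at most the expectation of
      [|V| (|x_v h| + |D_v h|) + |V'| (|x_u h| + |D_u h|) + |div| |h|].
    To avoid the singularity, [r] is replaced by [r + eta^2]; the divergence is then
    the approximate point mass [eta^2 / (r + eta^2)^2], the derivative of [g] along the
    field is [1 - eta^2 / (r + eta^2)], and [eta] tends to 0 at the end.

    The weights are unbounded, but each is dominated by a derivative, in one of the two
    directions, of a bounded function: [|V|] is at most [D_u angle / (2 a b)] with
    [angle = atan (U / sqrt (Y^2 + eta^2))], which is where the factor
    [1 / (a b) = 1 / sqrt (s1 s2)] comes from, and the divergence is at most such a
    derivative in both directions.  A second integration by parts
    ([bounded_weight_sqr_le]) bounds the expectation of [D W * p^2], for [W] bounded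
    and [p] a polynomial, by a multiple of the expectation of [p^2] that depends only
    on the degree of [p].

    It remains to bound [x_v h] and [D_v h] in mean square by [h].  This is an induction
    on the degree ([pmean_mder_sqr_le]) based on the commutation relation between [D_v]
    and its Gaussian adjoint.  No rotation of the Gaussian vector is needed: [stein]
    holds in every direction as a linear combination of its coordinate versions, which
    follow from Fubini's theorem ([coord_fubini]).  Adding up the terms gives the
    constant [40 max(d, 2)], where [max(d, 2)] bounds the degree of [h].

    Among three nonzero reals two have the same sign, and among the first three
    eigenvalues in decreasing order of modulus the product of any two is in modulus at
    least [|lambda_2 lambda_3|]; this gives the last claim. *)

(** * Integration by parts for the standard normal law on the line *)

Section gauss1.
Context {R : realType}.
Local Notation mu := (@lebesgue_measure R).
Local Notation gpdf := (normal_pdf (0:R) 1).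

(** The normal law is defined by integrating its density over sets; to integrate functions
    against it, the density is identified with the Radon-Nikodym derivative. *)
Lemma normal_prob_density :
  ae_eq mu setT (Radon_Nikodym_SigmaFinite.f (normal_prob (0:R) 1) mu)
    (fun t => (gpdf t)%:E).
Proof.
have dom := normal_prob_dominates (0:R) 1.
apply: integral_ae_eq => //=.
- exact: Radon_Nikodym_SigmaFinite.f_integrable.
- by apply/measurable_EFinP; exact: measurable_normal_pdf.
- by move=> E _ mE; rewrite -Radon_Nikodym_SigmaFinite.f_integral.
Qed.

Lemma ge0_integral_normal_prob (f : R -> \bar R) :
  (forall t, (0 <= f t)%E) -> measurable_fun setT f ->
  (\int[normal_prob (0:R) 1]_t f t = \int[mu]_t (f t * (gpdf t)%:E))%E.
Proof.
move=> f0 mf; have dom := normal_prob_dominates (0:R) 1.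
rewrite -(Radon_Nikodym_SigmaFinite.change_of_variables dom)//.
apply: ae_eq_integral => //.
- apply: emeasurable_funM => //.
  by apply: measurable_int (Radon_Nikodym_SigmaFinite.f_integrable dom).
- apply: emeasurable_funM => //.
  by apply/measurable_EFinP; exact: measurable_normal_pdf.
- by apply: ae_eqe_mul2l; exact: normal_prob_density.
Qed.

Lemma integrable_normal_prob (f : R -> R) : measurable_fun setT f ->
  mu.-integrable setT (fun t => (f t * gpdf t)%:E) ->
  (normal_prob (0:R) 1).-integrable setT (fun t => (f t)%:E).
Proof.
move=> mf /integrableP[_ fi]; apply/integrableP; split; first exact/measurable_EFinP.
rewrite ge0_integral_normal_prob//.
- apply: le_lt_trans fi; rewrite le_eqVlt; apply/orP; left; apply/eqP.
  apply: eq_integral => t _.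
  by rewrite /= normrM [`|gpdf t|]ger0_norm// normal_pdf_ge0.
- by apply/measurable_EFinP; exact: measurableT_comp.
Qed.


Lemma integral_normal_prob (f : R -> R) : measurable_fun setT f ->
  (\int[normal_prob (0:R) 1]_t (f t)%:E = \int[mu]_t (f t * gpdf t)%:E)%E.
Proof.
move=> mf; have p0 t : 0 <= gpdf t by exact: normal_pdf_ge0.
rewrite integralE [RHS]integralE; congr (_ - _)%E;
  rewrite ge0_integral_normal_prob//.
- apply: eq_integral => t _.
  by rewrite !funeposE -!EFin_max -EFinM maxr_pMl// mul0r.
- by apply: measurable_funepos; exact/measurable_EFinP.
- apply: eq_integral => t _.
  by rewrite !funenegE -!EFinN -!EFin_max -EFinM maxr_pMl// mul0r mulNr.
- by apply: measurable_funeneg; exact/measurable_EFinP.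
Qed.

(** Every exponent [a > 0] is allowed so that the induction on [m] can spend one half of
    it on one factor [1 + s] and leave the other half for the rest. *)
Lemma expr1D_le_expR (m : nat) (a : R) : 0 < a ->
  exists2 K, 0 <= K & forall s, 0 <= s -> (1 + s) ^+ m <= K * expR (a * s).
Proof.
elim: m a => [|m IH] a a0.
  exists 1 => // s s0; rewrite expr0 mul1r -expR0 ler_expR mulr_ge0//.
  exact: ltW.
have a20 : 0 < a / 2 by rewrite divr_gt0.
have [K K0 HK] := IH _ a20.
have b0 : 0 <= 1 + 2 / a by rewrite addr_ge0// divr_ge0// ltW.
exists ((1 + 2 / a) * K); first exact: mulr_ge0.
move=> s s0; rewrite exprS.
have -> : expR (a * s) = expR (a / 2 * s) * expR (a / 2 * s).
  by rewrite -expRD; congr expR; lra.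
rewrite mulrACA; apply: ler_pM => //; 
  [exact: addr_ge0|apply: exprn_ge0; exact: addr_ge0| |exact: HK].
have h : 1 + a / 2 * s <= expR (a / 2 * s) by exact: expR_ge1Dx.
apply: le_trans (ler_wpM2l b0 h).
have -> : (1 + 2 / a) * (1 + a / 2 * s) = 1 + s + (2 / a + a / 2 * s).
  by field; rewrite gt_eqF.
have a1 := ltW a0; rewrite lerDl; apply: addr_ge0; first exact: divr_ge0.
by apply: mulr_ge0 => //; exact: divr_ge0.
Qed.

Lemma normal_fun01 (t : R) : normal_fun 0 1 t = expR (- (t ^+ 2 / 2)).
Proof. by rewrite /normal_fun; congr expR; rewrite subr0 expr1n mulNr. Qed.

Lemma gpdfE (t : R) : gpdf t = normal_peak 1 * expR (- (t ^+ 2 / 2)).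
Proof. by rewrite normal_pdfE ?oner_neq0// normal_fun01. Qed.

(** Half of the Gaussian decay absorbs the polynomial; the remaining [exp (- t^2 / 4)] is
    the density of variance 2 up to a constant, whose integral is known. *)
Lemma growth_gpdf (m : nat) : exists2 K, 0 <= K &
  forall t, (1 + t ^+ 2) ^+ m * gpdf t <= K * normal_pdf 0 (Num.sqrt 2) t.
Proof.
have s20 : Num.sqrt 2 != 0 :> R by rewrite gt_eqF// sqrtr_gt0.
have a0 : 0 < 4^-1 :> R by rewrite invr_gt0.
have [K K0 HK] := expr1D_le_expR m a0.
have p0 := normal_peak_gt0 s20.
have q0 := @normal_peak_ge0 R 1.
exists (K * normal_peak 1 / normal_peak (Num.sqrt 2)).
  by rewrite divr_ge0 ?mulr_ge0// ltW.
move=> t; rewrite gpdfE normal_pdfE// [leRHS]mulrA divfK ?gt_eqF//.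
have -> : normal_fun 0 (Num.sqrt 2) t
    = expR (4^-1 * t ^+ 2) * expR (- (t ^+ 2 / 2)) :> R.
  rewrite -expRD /normal_fun; congr expR.
  by rewrite subr0 sqr_sqrtr// mulNr; lra.
set e := expR (- _); set e4 := expR (_ * _).
have -> : K * normal_peak 1 * (e4 * e) = K * e4 * (normal_peak 1 * e) by ring.
apply: ler_wpM2r; first by rewrite mulr_ge0// expR_ge0.
by apply: HK; exact: sqr_ge0.
Qed.

Lemma integrable_growth_gpdf (m : nat) :
  mu.-integrable setT (fun t => ((1 + t ^+ 2) ^+ m * gpdf t)%:E).
Proof.
have [K K0 HK] := growth_gpdf m.
have mf : measurable_fun setT (fun t : R => (1 + t ^+ 2) ^+ m * gpdf t).
  apply: measurable_funM; last exact: measurable_normal_pdf.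
  by apply: measurable_funX; apply: measurable_funD => //; exact: measurable_funX.
have := integrableZl measurableT K (integrable_normal_pdf 0 (Num.sqrt 2)).
apply: le_integrable => //; first exact/measurable_EFinP.
move=> t _; rewrite /= lee_fin ger0_norm ?mulr_ge0 ?normal_pdf_ge0 ?exprn_ge0//.
  by apply: le_trans (HK t) _; exact: ler_norm.
by rewrite addr_ge0// sqr_ge0.
Qed.

Lemma integrable_normal_prob_growth (f : R -> R) (C : R) (m : nat) :
  measurable_fun setT f -> (forall t, `|f t| <= C * (1 + t ^+ 2) ^+ m) ->
  (normal_prob (0:R) 1).-integrable setT (fun t => (f t)%:E).
Proof.
move=> mf fC; apply: integrable_normal_prob => //.
have := integrableZl measurableT C (integrable_growth_gpdf m).
have p0 t : 0 <= gpdf t by exact: normal_pdf_ge0.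
apply: le_integrable => //.
  by apply/measurable_EFinP; apply: measurable_funM => //; exact: measurable_normal_pdf.
move=> t _; rewrite /= lee_fin normrM [`|gpdf t|]ger0_norm//.
apply: le_trans (ler_norm _); rewrite mulrA; exact: ler_wpM2r.
Qed.

Lemma is_derive_gpdf (t : R) : is_derive t 1 gpdf (- t * gpdf t).
Proof.
have -> : gpdf = fun t => normal_peak 1 * expR (- (t ^+ 2 / 2)).
  by apply/funext => x; exact: gpdfE.
apply: is_derive_eq.
by rewrite /GRing.scale /=; field.
Qed.

Lemma is_derive_continuous (f : R -> R) (x a : R) :
  is_derive x 1 f a -> {for x, continuous f}.
Proof.
by move=> [df _]; apply: differentiable_continuous; exact/derivable1_diffP.
Qed.

(** One more power of [1 + t^2] than needed for boundedness is absorbed by the density, which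
    leaves a factor [1 / (1 + n^2)], hence a bound by a multiple of [1 / (n + 1)]. *)
Lemma gauss_boundary_cvg0 (u : R -> R) (C : R) (m : nat) :
  (forall t, `|u t| <= C * (1 + t ^+ 2) ^+ m) ->
  (fun n : nat => u n%:R * gpdf n%:R - u (- n%:R) * gpdf (- n%:R)) @ \oo --> (0 : R).
Proof.
move=> uC; have [K K0 HK] := growth_gpdf m.+1.
have C0 : 0 <= C.
  have := uC 0; rewrite expr0n addr0 expr1n mulr1; exact: le_trans.
have s20 : Num.sqrt 2 != 0 :> R by rewrite gt_eqF// sqrtr_gt0.
set M := C * (K * normal_peak (Num.sqrt 2)).
have M0 : 0 <= M by rewrite !mulr_ge0// normal_peak_ge0.
have p0 t : 0 <= gpdf t by exact: normal_pdf_ge0.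
have bnd t : `|u t * gpdf t| * (1 + t ^+ 2) <= M.
  have q0 : 0 <= 1 + t ^+ 2 by rewrite addr_ge0// sqr_ge0.
  rewrite normrM [`|gpdf t|]ger0_norm//.
  apply: (@le_trans _ _ (C * ((1 + t ^+ 2) ^+ m.+1 * gpdf t))).
    have -> : C * ((1 + t ^+ 2) ^+ m.+1 * gpdf t)
       = C * (1 + t ^+ 2) ^+ m * gpdf t * (1 + t ^+ 2) by rewrite exprS; ring.
    by apply: ler_wpM2r => //; apply: ler_wpM2r.
  apply: ler_wpM2l => //; apply: le_trans (HK t) _; apply: ler_wpM2l => //.
  exact: normal_pdf_ub.
have bnd2 n : `|u n%:R * gpdf n%:R - u (- n%:R) * gpdf (- n%:R)|
     <= 4 * M * harmonic n.
  rewrite /harmonic /= ler_pdivlMr ?ltr0Sn//.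
  apply: le_trans (ler_wpM2r (ler0n _ _) (ler_normB _ _)) _.
  (* [1 + n^2 >= (n + 1) / 2] turns both bounds into multiples of [1 / (n + 1)] *)
  have := bnd n%:R; have := bnd (- n%:R); rewrite sqrrN.
  set a := `|_ * _|; set b := `|_ * _| => h1 h2.
  have a0 : 0 <= a by exact: normr_ge0.
  have b0 : 0 <= b by exact: normr_ge0.
  rewrite -addn1 natrD; set x : R := n%:R in h1 h2 *.
  have : 0 <= (x - 1) ^+ 2 by exact: sqr_ge0.
  move: (a) (b) (x) a0 b0 h1 h2 {M0} => {}a {}b {}x a0 b0 h1 h2 h3.
  have h4 : x + 1 <= 2 * (1 + x ^+ 2) by nra.
  have := ler_wpM2l (addr_ge0 a0 b0) h4; lra.
apply: norm_cvg0; apply: (@squeeze_cvgr _ _ _ _ (fun=> 0) (fun n => 4 * M * harmonic n)).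
- by apply: nearW => n; rewrite normr_ge0 bnd2.
- exact: cvg_cst.
- rewrite -[X in _ --> X](mulr0 (4 * M)); apply: cvgMr; exact: cvg_harmonic.
Qed.

(** The integrand times the density [gpdf] is the derivative of [u * gpdf], so its integral
    over [[-n, n]] is a boundary term; dominated convergence gives the whole line. *)
Lemma gaussian_integration_by_parts (u u' : R -> R) (C : R) (m : nat) :
  (forall t : R, is_derive t 1 u (u' t)) -> continuous u' ->
  (forall t, `|u t| <= C * (1 + t ^+ 2) ^+ m) ->
  (forall t, `|u' t| <= C * (1 + t ^+ 2) ^+ m) ->
  (\int[normal_prob (0:R) 1]_t (u' t - t * u t)%:E = 0)%E.
Proof.
move=> du cu' uC u'C.
have cu : continuous u by move=> t; exact: is_derive_continuous (du t).
have mu1 : measurable_fun setT u by exact: continuous_measurable_fun.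
have mu' : measurable_fun setT u' by exact: continuous_measurable_fun.
have mf : measurable_fun setT (fun t => u' t - t * u t).
  by apply: measurable_funB => //; apply: measurable_funM.
rewrite integral_normal_prob//.
set h := fun t => (u' t - t * u t) * gpdf t.
have ch : continuous h.
  have cg : continuous gpdf by apply: continuous_normal_pdf; exact: oner_neq0.
  move=> t; apply: cvgM; last exact: cg.
  by apply: cvgB; [exact: cu'|apply: cvgM; [exact: cvg_id|exact: cu]].
have p0 t : 0 <= gpdf t by exact: normal_pdf_ge0.
have C0 : 0 <= C.
  have := uC 0; rewrite expr0n addr0 expr1n mulr1; exact: le_trans.
pose F t := u t * gpdf t.
have dF (t : R) : is_derive t 1 F (h t).
  have := du t; have := is_derive_gpdf t => d1 d2.
  rewrite /F; apply: is_derive_eq.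
  by rewrite /GRing.scale /= /h; ring.
pose f_ (n : nat) := EFin \o (h \_ `[- n%:R, n%:R]).
have If n : (0 < n)%N -> (\int[mu]_t f_ n t = (F n%:R - F (- n%:R))%:E)%E.
  move=> n0; have nn : (- n%:R < n%:R :> R).
    by rewrite -subr_gt0 opprK -natrD ltr0n addn_gt0 n0.
  have := @continuous_FTC2 R h F (- n%:R) n%:R nn.
  rewrite integral_mkcond /f_ restrict_EFin => -> //.
  - exact: continuous_subspaceT.
  - have cF : continuous F by move=> t; exact: is_derive_continuous (dF t).
    split.
    + by move=> t _; have [] := dF t.
    + exact/cvg_at_right_filter/cF.
    + exact/cvg_at_left_filter/cF.
  - by move=> t _; rewrite derive1E; have [_ ->] := dF t.
have lim1 : (\int[mu]_t f_ n t @[n --> \oo] --> \int[mu]_t (h t)%:E)%E.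
  have := integrableZl measurableT C (integrable_growth_gpdf m.+1) => ig.
  have ig2 := integrableD measurableT ig ig.
  have mh : measurable_fun setT h.
    by apply: measurable_funM => //; exact: measurable_normal_pdf.
  apply: (@dominated_cvg _ _ _ mu setT measurableT f_ (fun t => (h t)%:E)
    ((fun t => C%:E * ((1 + t ^+ 2) ^+ m.+1 * gpdf t)%:E)
     \+ (fun t => C%:E * ((1 + t ^+ 2) ^+ m.+1 * gpdf t)%:E))%E).
  - move=> n; apply/measurable_EFinP.
    by apply: (measurable_restrictT _ _).1 => //; exact: measurable_funTS mh.
  - move=> t _; apply: cvg_near_cst; near=> n.
    rewrite /f_ /= patchE mem_set//= in_itv/= -ler_norml.
    by near: n; exact: nbhs_infty_ger.
  - by move=> t _.
  - exact: ig2.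
  - move=> n t _; rewrite /f_ /= -!EFinM -EFinD lee_fin.
    apply: (@le_trans _ _ `|h t|).
      by rewrite patchE; case: ifP => // _; rewrite normr0.
    rewrite /h normrM [`|gpdf t|]ger0_norm// exprS.
    have q1 : 1 <= 1 + t ^+ 2 by rewrite lerDl sqr_ge0.
    have q2 : `|t| <= 1 + t ^+ 2 by rewrite ler_norml; apply/andP; split; nra.
    have := u'C t; have := uC t.
    set q := _ ^+ m => h1 h2.
    have Cq : 0 <= C * q by apply: le_trans h2.
    have h3 : `|u' t - t * u t| <= C * q * (1 + t ^+ 2) + C * q * (1 + t ^+ 2).
      apply: le_trans (ler_normB _ _) _; rewrite normrM; apply: lerD.
        by apply: le_trans h2 _; rewrite ler_peMr.
      by rewrite mulrC; apply: ler_pM.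
    apply: (le_trans (ler_wpM2r (p0 t) h3)); rewrite le_eqVlt; apply/orP.
    by left; apply/eqP; rewrite /h; ring.
have lim2 : ((F n%:R - F (- n%:R))%:E @[n --> \oo] --> (0 : \bar R))%E.
  by apply: cvg_EFin; [exact: nearW|exact: (gauss_boundary_cvg0 uC)].
apply: (cvg_unique (@ereal_hausdorff R) lim1).
apply: cvg_trans lim2; apply: near_eq_cvg; near=> n.
by rewrite If//; near: n; exact: nbhs_infty_gt.
Unshelve. all: by end_near. Qed.

End gauss1.

(** * Fubini's theorem for one coordinate of an independent family *)
Section coordinate.
Context {R : realType} {n : nat}.
Implicit Types (x : 'I_n -> R) (G : ('I_n -> R) -> R).

Definition upd x (i : 'I_n) (t : R) : 'I_n -> R :=
  fun j => if j == i then t else x j.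

Lemma upd_id x i : upd x i (x i) = x.
Proof. by apply/funext => j; rewrite /upd; case: eqP => // ->. Qed.

Lemma upd_same x i t : upd x i t i = t.
Proof. by rewrite /upd eqxx. Qed.

Lemma upd_upd x i s t : upd (upd x i s) i t = upd x i t.
Proof. by apply/funext => j; rewrite /upd; case: eqP. Qed.

(** Borel functions of [n] real variables, described by their compositions with measurable
    maps, which avoids a sigma-algebra on the function space. *)
Definition borel G : Prop :=
  forall (d : measure_display) (S : measurableType d) (X : 'I_n -> S -> R),
    (forall j, measurable_fun setT (X j)) ->
    measurable_fun setT (fun s => G (fun j => X j s)).

End coordinate.

Section independent_coordinate.
Context {disp : measure_display} {T : measurableType disp} {R : realType}.
Variables (P : probability T R) (n : nat) (Z : 'I_n -> {RV P >-> R}).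
Hypothesis normalZ : standard_normal_vector P Z.
Variable i : 'I_n.

(** Events about the coordinates other than [i]; these cylinders form a pi-system. *)
Definition cylinder (A : 'I_n -> set R) : set T :=
  [set w | forall j, j != i -> A j (Z j w)].

Definition cylinders : set (set T) :=
  [set E | exists2 A, (forall j, measurable (A j)) & E = cylinder A].

Lemma cylinder_bigcap A :
  cylinder A = \bigcap_(j in [set` [set~ i]%SET]) (Z j @^-1` A j).
Proof.
apply/seteqP; split => w /= h j.
  by rewrite /= finset.in_setC1 => ji; exact: h.
by move=> ji; apply: (h j) => /=; rewrite finset.in_setC1.
Qed.

Lemma measurable_cylinder A : (forall j, measurable (A j)) -> measurable (cylinder A).
Proof.
move=> mA; rewrite cylinder_bigcap; apply: fin_bigcap_measurable => //= j _.
by rewrite -[_ @^-1` _]setTI; exact: measurable_funP.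
Qed.

Lemma cylindersI : setI_closed cylinders.
Proof.
move=> _ _ [A mA ->] [B mB ->]; exists (fun j => A j `&` B j).
  by move=> j; exact: measurableI.
apply/seteqP; split => w /=; rewrite /cylinder /=.
  by move=> [hA hB] j ji; split; [exact: hA|exact: hB].
by move=> h; split => j ji; have [] := h _ ji.
Qed.

Lemma cylindersT : cylinders setT.
Proof.
by exists (fun=> setT) => //; apply/seteqP; split.
Qed.

Lemma independent_cylinder (C : set R) A : measurable C -> (forall j, measurable (A j)) ->
  (P (cylinder A `&` (Z i @^-1` C)) = normal_prob 0 1 C * P (cylinder A))%E.
Proof.
move=> mC mA; have [law indep] := normalZ.
pose A' j := if j == i then C else A j.
have mA' j : measurable (A' j) by rewrite /A'; case: ifP.
have -> : cylinder A `&` (Z i @^-1` C)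
    = \bigcap_(j in [set` [set: 'I_n]%SET]) (Z j @^-1` A' j).
  apply/seteqP; split => w /=.
    move=> [h hC] j _ /=; rewrite /A'; case: eqP => [->//|/eqP ji]; exact: h.
  move=> h; split.
    by move=> j ji; have := h j; rewrite /A' /= (negbTE ji); apply; rewrite finset.in_setT.
  by have := h i; rewrite /A' /= eqxx; apply; rewrite finset.in_setT.
rewrite indep; last by move=> j _; exact: mA'.
rewrite (bigD1 i) ?finset.in_setT//= -(law i C mC) /distribution /pushforward {1}/A' eqxx.
congr (_ * _)%E; rewrite cylinder_bigcap indep//.
apply: eq_big => [j|j /andP[_ ji]]; first by rewrite finset.in_setT finset.in_setC1.
by rewrite /A' (negbTE ji).
Qed.

(** For a fixed [C] both sides are finite measures of [E] that agree on the cylinders, so they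
    agree on the sigma-algebra that the cylinders generate. *)
Lemma independent_sigma (C : set R) E : measurable C -> <<s cylinders >> E ->
  (P (E `&` (Z i @^-1` C)) = normal_prob 0 1 C * P E)%E.
Proof.
move=> mC sE.
have mZC : measurable (Z i @^-1` C).
  by rewrite -[_ @^-1` _]setTI; exact: measurable_funP.
have p0 : 0 <= fine (normal_prob (0:R) 1 C) by exact: fine_ge0.
have pE : ((fine (normal_prob (0:R) 1 C))%:E = normal_prob (0:R) 1 C)%E.
  by rewrite fineK// fin_num_measure.
rewrite -pE.
apply: (@g_sigma_algebra_measure_unique _ R T cylinders _ (fun=> setT) _ _
  (mrestr P mZC) (mscale (NngNum p0) P) cylindersI _ _ E sE).
- by move=> _ [A mA ->]; exact: measurable_cylinder.
- by move=> _; exact: cylindersT.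
- by rewrite bigcup_const//; exists 0%N.
- move=> _ [A mA ->]; apply: (eq_trans (independent_cylinder mC mA)).
  by congr (_ * _)%E; exact/esym/pE.
- move=> _; have mT := measurableI _ _ (measurableT : measurable (setT : set T)) mZC.
  by apply: (le_lt_trans (probability_le1 P mT)); exact: ltry.
Qed.

Notation T' := (g_sigma_algebraType cylinders).

(** The sample space with the coarser sigma-algebra of the coordinates [j != i] serves as the
    second factor of the product, because its events are independent of [Z i]. *)
Definition others (w : T) : T' := w.

Lemma measurable_others : measurable_fun setT others.
Proof.
move=> _ B mB; rewrite setTI.
have : <<s cylinders >> `<=` @measurable _ T.
  apply: smallest_sub; first exact: sigma_algebra_measurable.
  by move=> _ [A mA ->]; exact: measurable_cylinder.
by apply.
Qed.

HB.instance Definition _ := isMeasurableFun.Build _ _ T T' others measurable_others.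

(** [Z i] with values in the copy of the line on which the normal law is defined. *)
Definition coord (w : T) : measurableTypeR R := Z i w.

Lemma measurable_coord : measurable_fun setT coord.
Proof. exact: (measurable_funP (Z i)). Qed.

HB.instance Definition _ :=
  isMeasurableFun.Build _ _ T (measurableTypeR R) coord measurable_coord.

Definition coord_others (w : T) : measurableTypeR R * T' := (Z i w, w).

Lemma measurable_coord_others : measurable_fun setT coord_others.
Proof.
by apply: measurable_fun_pair; [exact: measurable_coord|exact: measurable_others].
Qed.

HB.instance Definition _ :=
  isMeasurableFun.Build _ _ T (measurableTypeR R * T')%type coord_others measurable_coord_others.

Lemma measurable_other j : j != i -> measurable_fun setT (Z j : T' -> R).
Proof.
move=> ji _ B mB; rewrite setTI; apply: sub_sigma_algebra.
exists (fun k => if k == j then B else setT).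
  by move=> k; case: ifP.
apply/seteqP; split => w /=; rewrite /cylinder /=.
  by move=> h k ki; case: eqP => [->|].
by move=> h; have := h _ ji; rewrite eqxx.
Qed.

(** By [independent_sigma] the joint law of [Z i] and the other coordinates is a product, and
    the inner integral of Fubini's theorem runs over the [i]-th variable alone. *)
Lemma coord_fubini (H : ('I_n -> R) -> R) : borel H ->
  P.-integrable setT (fun w => (H (fun j => Z j w))%:E) ->
  (forall x, \int[normal_prob 0 1]_t (H (upd x i t))%:E = 0)%E ->
  (\int[P]_w (H (fun j => Z j w))%:E = 0)%E.
Proof.
move=> bH iH H0.
pose H' (p : measurableTypeR R * T') : \bar R := (H (upd (fun j => Z j p.2) i p.1))%:E.
have mH' : measurable_fun setT H'.
  apply/measurable_EFinP.
  apply: (bH _ (measurableTypeR R * T')%type (fun j p => upd (fun j => Z j p.2) i p.1 j)) => j.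
  rewrite /upd; case: eqP => [_|/eqP ji]; first exact: measurable_fst.
  apply: (measurableT_comp (measurable_other ji)); exact: measurable_snd.
have HE w : (H (fun j => Z j w))%:E = (H' \o coord_others) w.
  by rewrite /H' /= /upd; congr (H _)%:E; apply/funext => j; case: eqP => [->|].
have iH' : P.-integrable setT (H' \o coord_others).
  by apply: eq_integrable iH => // w _; rewrite HE.
under eq_integral do rewrite HE.
rewrite -(integral_distribution mH' iH').
pose m1 := distribution P coord.
pose m2 := distribution P others.
have [law _] := normalZ.
have prodE (X : set (measurableTypeR R * T')) : measurable X ->
    (distribution P coord_others X = (m1 \x m2)%E X)%E.
  move=> mX; apply/esym.
  apply: (@product_measure_unique _ _ _ _ R m1 m2
    (distribution P coord_others) _ X mX) => A B mA mB.
  apply: (@eq_trans _ _ (normal_prob 0 1 A * P B)%E); last first.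
    by congr (_ * _)%E; exact/esym/law.
  apply: (eq_trans _ (independent_sigma mA mB)).
  by congr (P _); apply/seteqP; split => w /= [].
rewrite (eq_measure_integral (m1 \x m2)%E); last by move=> X mX _; exact: prodE.
have iprod : (m1 \x m2)%E.-integrable setT H'.
  have : (distribution P coord_others).-integrable setT H'.
    exact: integrable_pushforward.
  move=> /integrableP[_ fin]; apply/integrableP; split => //.
  move: fin; rewrite (eq_measure_integral (m1 \x m2)%E)//.
  by move=> X mX _; exact: prodE.
rewrite -integral21_prod_meas1//.
have H0' x : (\int[m1]_t (H (upd x i t))%:E = 0)%E.
  by rewrite -[RHS](H0 x); apply: eq_measure_integral => A mA _; exact: law.
rewrite (eq_integral (cst 0%E)) ?integral0// => w _.
exact: (H0' (fun j => Z j w)).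
Qed.

End independent_coordinate.

(** * Tame functions and directional derivatives *)
Section tame.
Context {R : realType} {n : nat}.
Implicit Types (x v : 'I_n -> R) (G H : ('I_n -> R) -> R).

Definition weight x : R := 1 + \sum_(j < n) x j ^+ 2.

Lemma weight_ge1 x : 1 <= weight x.
Proof. by rewrite lerDl sumr_ge0// => j _; exact: sqr_ge0. Qed.

Lemma weight_ge0 x : 0 <= weight x.
Proof. exact: le_trans (weight_ge1 x). Qed.

Lemma le_coord_weight x i : `|x i| <= weight x.
Proof.
have h : x i ^+ 2 <= \sum_(j < n) x j ^+ 2.
  by rewrite (bigD1 i)//= lerDl sumr_ge0// => j _; exact: sqr_ge0.
by rewrite ler_norml /weight; apply/andP; split; nra.
Qed.

Lemma weight_upd x i t : weight (upd x i t) <= weight x * (1 + t ^+ 2).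
Proof.
have h0 : 0 <= \sum_(j < n | j != i) x j ^+ 2.
  by rewrite sumr_ge0// => j _; exact: sqr_ge0.
rewrite /weight (bigD1 i)//= upd_same.
rewrite (eq_bigr (fun j => x j ^+ 2)); last by move=> j ji; rewrite /upd (negbTE ji).
rewrite [\sum_(j < n) x j ^+ 2](bigD1 i)//=.
have := sqr_ge0 t; have := sqr_ge0 (x i); nra.
Qed.

Definition poly_growth G : Prop :=
  exists C m, 0 <= C /\ forall x, `|G x| <= C * weight x ^+ m.

Definition tame G : Prop := borel G /\ poly_growth G.

Lemma tame_cst c : tame (fun=> c).
Proof.
split; first by move=> d S X mX; exact: measurable_cst.
by exists `|c|, 0%N; split => // x; rewrite expr0 mulr1.
Qed.

Lemma tame_coord i : tame (fun x => x i).
Proof.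
split; first by move=> d S X mX; exact: mX.
by exists 1, 1%N; split => // x; rewrite expr1 mul1r le_coord_weight.
Qed.

Lemma tameD G H : tame G -> tame H -> tame (fun x => G x + H x).
Proof.
move=> [bG [C1 [m1 [C10 hG]]]] [bH [C2 [m2 [C20 hH]]]]; split.
  by move=> d S X mX; apply: measurable_funD; [exact: bG|exact: bH].
exists (C1 + C2), (m1 + m2)%N; split; first exact: addr_ge0.
move=> x; rewrite mulrDl; apply: le_trans (ler_normD _ _) _; apply: lerD.
  apply: le_trans (hG x) _; apply: ler_wpM2l => //.
  by apply: ler_weXn2l; [exact: weight_ge1|exact: leq_addr].
apply: le_trans (hH x) _; apply: ler_wpM2l => //.
by apply: ler_weXn2l; [exact: weight_ge1|exact: leq_addl].
Qed.

Lemma tameM G H : tame G -> tame H -> tame (fun x => G x * H x).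
Proof.
move=> [bG [C1 [m1 [C10 hG]]]] [bH [C2 [m2 [C20 hH]]]]; split.
  by move=> d S X mX; apply: measurable_funM; [exact: bG|exact: bH].
exists (C1 * C2), (m1 + m2)%N; split; first exact: mulr_ge0.
by move=> x; rewrite normrM exprD mulrACA; exact: ler_pM.
Qed.

Lemma tameZ c G : tame G -> tame (fun x => c * G x).
Proof. by move=> tG; apply: tameM => //; exact: tame_cst. Qed.

Lemma tameN G : tame G -> tame (fun x => - G x).
Proof.
move=> /(tameZ (-1)); congr tame; apply/funext => x; exact: mulN1r.
Qed.

Lemma tameB G H : tame G -> tame H -> tame (fun x => G x - H x).
Proof. by move=> tG tH; apply: tameD => //; exact: tameN. Qed.

Lemma tameX G k : tame G -> tame (fun x => G x ^+ k).
Proof.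
move=> tG; elim: k => [|k IH].
  by under [X in tame X]funext do rewrite expr0; exact: tame_cst.
by under [X in tame X]funext do rewrite exprS; exact: tameM.
Qed.

Lemma tame_sum (I : Type) (r : seq I) (F : I -> ('I_n -> R) -> R) :
  (forall k, tame (F k)) -> tame (fun x => \sum_(k <- r) F k x).
Proof.
move=> tF; elim: r => [|k r IH].
  by under [X in tame X]funext do rewrite big_nil; exact: tame_cst.
by under [X in tame X]funext do rewrite big_cons; exact: tameD.
Qed.

Lemma tame_comp (f : R -> R) G : measurable_fun setT f ->
  tame G -> poly_growth (f \o G) -> tame (fun x => f (G x)).
Proof.
move=> mf [bG _] gr; split => // d S X mX.
by apply: (measurableT_comp mf); exact: bG.
Qed.

Lemma tame_norm G : tame G -> tame (fun x => `|G x|).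
Proof.
move=> tG; apply: (tame_comp _ tG); first exact: normr_measurable.
have [_ [C [m [C0 hG]]]] := tG.
by exists C, m; split => // x; rewrite /= normr_id.
Qed.

Lemma bounded_poly_growth G C : (forall x, `|G x| <= C) -> poly_growth G.
Proof.
move=> hC; exists C, 0%N; split; first exact: le_trans (hC (fun=> 0)).
by move=> x; rewrite expr0 mulr1.
Qed.

Definition linear_form v x : R := \sum_i v i * x i.

Lemma tame_linear_form v : tame (linear_form v).
Proof.
by apply: tame_sum => k; apply: tameM; [exact: tame_cst|exact: tame_coord].
Qed.

(** Only the sections in one variable are differentiated, which is all that integration by
    parts in each coordinate uses. *)
Definition is_gradient G (dG : 'I_n -> ('I_n -> R) -> R) : Prop :=
  tame G /\ forall i, [/\ tame (dG i),
    forall x, is_derive (x i) 1 (fun t => G (upd x i t)) (dG i x) &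
    forall x, continuous (fun t => dG i (upd x i t))].

(** [dirder v G G'] says that [G'] is the derivative of [G] in the direction [v]; it asks for
    the whole gradient because integration by parts along [v] is deduced from the
    coordinate directions. *)
Definition dirder v G G' : Prop :=
  exists2 dG, is_gradient G dG & forall x, G' x = \sum_i v i * dG i x.

Lemma dirder_tame v G G' : dirder v G G' -> tame G /\ tame G'.
Proof.
move=> [dG [tG h] /funext ->]; split => //; apply: tame_sum => k.
by apply: tameZ; have [] := h k.
Qed.

Lemma gradient_continuous G dG x i : is_gradient G dG ->
  continuous (fun t => G (upd x i t)).
Proof.
move=> [_ /(_ i)[_ d _]] t; have := d (upd x i t); rewrite upd_same.
under [X in is_derive _ _ X _]funext do rewrite upd_upd.
exact: is_derive_continuous.
Qed.

Lemma dirder_cst v c : dirder v (fun=> c) (fun=> 0).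
Proof.
exists (fun _ _ => 0); last by move=> x; rewrite big1// => i _; rewrite mulr0.
split; first exact: tame_cst.
move=> i; split; first exact: tame_cst.
- by move=> x; exact: is_derive_cst.
- by move=> x t; exact: cvg_cst.
Qed.

Lemma dirder_coord v i : dirder v (fun x => x i) (fun=> v i).
Proof.
exists (fun j _ => (i == j)%:R).
  split; first exact: tame_coord.
  move=> j; split; first exact: tame_cst.
  - move=> x; rewrite /upd; case: eqP => [_|_].
      exact: is_derive_id.
    exact: is_derive_cst.
  - by move=> x t; exact: cvg_cst.
move=> x; rewrite (bigD1 i)//= eqxx mulr1 big1 ?addr0// => j ji.
by rewrite eq_sym (negbTE ji) mulr0.
Qed.

Lemma dirderD v G H G' H' : dirder v G G' -> dirder v H H' ->
  dirder v (fun x => G x + H x) (fun x => G' x + H' x).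
Proof.
move=> [dG gG EG] [dH gH EH]; exists (fun i x => dG i x + dH i x); last first.
  by move=> x; rewrite EG EH -big_split/=; apply: eq_bigr => i _; rewrite mulrDr.
case: (gG) (gH) => tG hG [tH hH]; split; first exact: tameD.
move=> i; have [tdG DG cG] := hG i; have [tdH DH cH] := hH i; split.
- exact: tameD.
- by move=> x; have ? := DG x; have ? := DH x; exact: is_deriveD.
- by move=> x t; apply: cvgD; [exact: cG|exact: cH].
Qed.

Lemma dirderM v G H G' H' : dirder v G G' -> dirder v H H' ->
  dirder v (fun x => G x * H x) (fun x => G' x * H x + G x * H' x).
Proof.
move=> [dG gG EG] [dH gH EH].
exists (fun i x => dG i x * H x + G x * dH i x); last first.
  move=> x; rewrite EG EH mulr_suml mulr_sumr -big_split/=.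
  by apply: eq_bigr => i _; rewrite mulrDr !mulrA [G x * v i]mulrC.
case: (gG) (gH) => tG hG [tH hH]; split; first exact: tameM.
move=> i; have [tdG DG cG] := hG i; have [tdH DH cH] := hH i; split.
- by apply: tameD; exact: tameM.
- move=> x; have d1 := DG x; have d2 := DH x.
  apply: is_derive_eq; rewrite /GRing.scale /= !upd_id; ring.
- move=> x t; apply: cvgD.
    by apply: cvgM; [exact: cG|exact: (gradient_continuous gH)].
  by apply: cvgM; [exact: (gradient_continuous gG)|exact: cH].
Qed.

Lemma dirder_comp v (f f' : R -> R) G G' : dirder v G G' ->
  measurable_fun setT f -> measurable_fun setT f' ->
  (forall x, is_derive (G x) 1 f (f' (G x))) ->
  (forall x, {for G x, continuous f'}) ->
  poly_growth (f \o G) -> poly_growth (f' \o G) ->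
  dirder v (fun x => f (G x)) (fun x => f' (G x) * G' x).
Proof.
move=> [dG gG EG] mf mf' df cf' gf gf'.
exists (fun i x => f' (G x) * dG i x); last first.
  by move=> x; rewrite EG mulr_sumr; apply: eq_bigr => i _; rewrite mulrCA.
case: (gG) => tG hG; split; first exact: tame_comp.
move=> i; have [tdG DG cG] := hG i; split.
- by apply: tameM => //; exact: tame_comp.
- move=> x; have d1 := DG x.
  have d2 : is_derive (G (upd x i (x i))) 1 f (f' (G x)) by rewrite upd_id; exact: df.
  exact: (is_derive1_comp (f := f) (g := fun t => G (upd x i t)) d2 d1).
- move=> x t; apply: cvgM; last exact: cG.
  apply: (@continuous_comp _ _ _ (fun t => G (upd x i t)) f').
    exact: (gradient_continuous gG).
  exact: cf'.
Qed.

End tame.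

Lemma section_growth {R : realType} {n : nat} (G : ('I_n -> R) -> R) (C D : R)
    (m M : nat) (x : 'I_n -> R) (i : 'I_n) (t : R) :
  0 <= C -> (forall y, `|G y| <= C * weight y ^+ m) ->
  C * weight x ^+ m <= D -> (m <= M)%N ->
  `|G (upd x i t)| <= D * (1 + t ^+ 2) ^+ M.
Proof.
move=> C0 hG CD mM; have t1 : 1 <= 1 + t ^+ 2 by rewrite lerDl sqr_ge0.
have t0 : 0 <= 1 + t ^+ 2 by exact: le_trans t1.
apply: le_trans (hG _) _.
apply: (@le_trans _ _ (C * weight x ^+ m * (1 + t ^+ 2) ^+ m)).
  rewrite -mulrA -exprMn; apply: ler_wpM2l => //.
  by rewrite lerXn2r ?nnegrE ?weight_ge0 ?weight_upd// mulr_ge0// weight_ge0.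
apply: ler_pM => //; rewrite ?exprn_ge0//.
- by rewrite mulr_ge0// exprn_ge0// weight_ge0.
- exact: ler_weXn2l.
Qed.

(** * Expectations of tame functions of a standard normal vector *)
Section expectation.
Context {disp : measure_display} {T : measurableType disp} {R : realType}.
Variables (P : probability T R) (n : nat) (Z : 'I_n -> {RV P >-> R}).
Hypothesis normalZ : standard_normal_vector P Z.
Implicit Types (G H : ('I_n -> R) -> R).

(** Moments of all orders are asked for at once because this class, unlike integrability, is
    stable under powers. *)
Definition all_moments (X : T -> R) : Prop :=
  measurable_fun setT X /\
  forall k, P.-integrable setT (fun w => (`|X w| ^+ k)%:E).

Lemma all_moments_cst c : all_moments (fun=> c).
Proof.
split; first exact: measurable_cst.
by move=> k; exact: finite_measure_integrable_cst.
Qed.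

Lemma all_momentsD (X Y : T -> R) : all_moments X -> all_moments Y ->
  all_moments (fun w => X w + Y w).
Proof.
move=> [mX iX] [mY iY]; split; first exact: measurable_funD.
move=> k; have i1 := integrableD measurableT (iX k) (iY k).
have := integrableZl measurableT (2 ^+ k) i1.
apply: le_integrable => //.
  apply/measurable_EFinP; apply: measurable_funX; apply: measurableT_comp => //.
  exact: measurable_funD.
move=> w _; rewrite /= lee_fin (ger0_norm (exprn_ge0 k (normr_ge0 _))).
apply: le_trans (ler_norm _).
apply: (@le_trans _ _ ((2 * Num.max `|X w| `|Y w|) ^+ k)).
  apply: lerXn2r.
  - by rewrite nnegrE.
  - by rewrite nnegrE mulr_ge0// le_max normr_ge0.
  apply: le_trans (ler_normD _ _) _.
  rewrite mulrDl mul1r lerD// le_max lexx ?orbT//.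
rewrite exprMn; apply: ler_wpM2l; first exact: exprn_ge0.
by rewrite maxEle; case: ifP => _; rewrite ?lerDl ?lerDr exprn_ge0.
Qed.

Lemma all_momentsX (X : T -> R) j : all_moments X -> all_moments (fun w => X w ^+ j).
Proof.
move=> [mX iX]; split; first exact: measurable_funX.
move=> k; have := iX (j * k)%N; congr (_.-integrable _ _); apply/funext => w.
by rewrite exprM normrX.
Qed.

Lemma all_moments_coord i : all_moments (Z i).
Proof.
split; first exact: measurable_funP.
move=> k.
have mf : measurable_fun setT (fun t : R => `|t| ^+ k).
  by apply: measurable_funX; exact: normr_measurable.
have iN : (normal_prob (0:R) 1).-integrable setT (fun t => (`|t| ^+ k)%:E).
  apply: (@integrable_normal_prob_growth _ _ 1 k) => // t.
  rewrite mul1r ger0_norm ?exprn_ge0// lerXn2r ?nnegrE ?addr_ge0 ?sqr_ge0//.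
  by rewrite ler_norml; apply/andP; split; have := sqr_ge0 t; nra.
apply/integrableP; split.
  by apply/measurable_EFinP; exact: (measurableT_comp mf).
move/integrableP : iN => [mN]; apply: le_lt_trans.
rewrite le_eqVlt; apply/orP; left; apply/eqP.
have [law _] := normalZ.
transitivity (\int[distribution P (coord Z i)]_t `|(`|t| ^+ k)%:E|)%E.
  by rewrite ge0_integral_distribution//; exact: measurableT_comp.
by apply: eq_measure_integral => A mA _; exact: law.
Qed.

Lemma all_moments_weight : all_moments (fun w => weight (fun j => Z j w)).
Proof.
apply: all_momentsD; first exact: all_moments_cst.
elim: (index_enum 'I_n) => [|j r IH].
  by under [X in all_moments X]funext do rewrite big_nil; exact: all_moments_cst.
under [X in all_moments X]funext do rewrite big_cons; apply: all_momentsD => //.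
by apply: all_momentsX; exact: all_moments_coord.
Qed.

Lemma integrable_tame G : tame G ->
  P.-integrable setT (fun w => (G (fun j => Z j w))%:E).
Proof.
move=> [bG [C [m [C0 hG]]]]; have [_ iW] := all_moments_weight.
have := integrableZl measurableT C (iW m).
apply: le_integrable => //.
  by apply/measurable_EFinP; apply: bG => j; exact: measurable_funP.
move=> w _; rewrite /= lee_fin; apply: le_trans (hG _) _.
rewrite [X in _ <= `|_ * X ^+ _|]ger0_norm ?weight_ge0//.
exact: ler_norm.
Qed.

Definition expect G : R := (\int[P]_w G (fun j => Z j w))%R.

Lemma expect_EFin G : tame G -> (\int[P]_w (G (fun j => Z j w))%:E = (expect G)%:E)%E.
Proof.
by move=> tG; rewrite /expect /Rintegral fineK//; exact: integrable_fin_num (integrable_tame tG).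
Qed.

Lemma expect_cst c : expect (fun=> c) = c.
Proof.
by rewrite /expect Rintegral_cst//= (probability_setT P) mulr1.
Qed.

Lemma expectD G H : tame G -> tame H -> expect (fun x => G x + H x) = expect G + expect H.
Proof. by move=> tG tH; apply: RintegralD => //; exact: integrable_tame. Qed.

Lemma expectB G H : tame G -> tame H -> expect (fun x => G x - H x) = expect G - expect H.
Proof. by move=> tG tH; apply: RintegralB => //; exact: integrable_tame. Qed.

Lemma expectZ c G : tame G -> expect (fun x => c * G x) = c * expect G.
Proof. by move=> tG; apply: RintegralZl => //; exact: integrable_tame. Qed.

Lemma expect_sum (I : Type) (r : seq I) (F : I -> ('I_n -> R) -> R) :
  (forall k, tame (F k)) ->
  expect (fun x => \sum_(k <- r) F k x) = \sum_(k <- r) expect (F k).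
Proof.
move=> tF; elim: r => [|k r IH].
  by under [X in expect X]funext do rewrite big_nil; rewrite expect_cst big_nil.
under [X in expect X]funext do rewrite big_cons.
by rewrite expectD ?big_cons ?IH//; exact: tame_sum.
Qed.

Lemma expect_le G H : tame G -> tame H -> (forall x, G x <= H x) -> expect G <= expect H.
Proof.
by move=> tG tH GH; apply: le_Rintegral => //; exact: integrable_tame.
Qed.

Lemma expect_ge0 G : (forall x, 0 <= G x) -> 0 <= expect G.
Proof. by move=> G0; exact: Rintegral_ge0. Qed.

(** The function [dG i x - x i * G x] has integral 0 in its [i]-th variable, by the
    one-dimensional formula, whatever the other variables are. *)
Lemma stein_coord G dG i : is_gradient G dG -> expect (dG i) = expect (fun x => x i * G x).
Proof.
move=> gG; have [tG /(_ i)[tdG d cd]] := gG.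
have tH : tame (fun x => dG i x - x i * G x).
  by apply: tameB => //; apply: tameM => //; exact: tame_coord.
apply/eqP; rewrite -subr_eq0 -expectB//; last by apply: tameM => //; exact: tame_coord.
rewrite /expect /Rintegral (coord_fubini normalZ (i := i) (H := fun x => dG i x - x i * G x))//.
- by case: tH.
- exact: (integrable_tame tH).
- move=> x; have [_ [C1 [m1 [C10 h1]]]] := tG; have [_ [C2 [m2 [C20 h2]]]] := tdG.
  under eq_integral do rewrite upd_same.
  apply: (@gaussian_integration_by_parts _ (fun t => G (upd x i t)) (fun t => dG i (upd x i t))
    (C1 * weight x ^+ m1 + C2 * weight x ^+ m2) (m1 + m2)) => //.
  + move=> t; have := d (upd x i t); rewrite upd_same.
    by under [X in is_derive _ _ X _]funext do rewrite upd_upd.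
  + move=> t; apply: (section_growth _ _ C10 h1 _ (leq_addr _ _)) => //.
    by rewrite lerDl mulr_ge0// exprn_ge0// weight_ge0.
  + move=> t; apply: (section_growth _ _ C20 h2 _ (leq_addl _ _)) => //.
    by rewrite lerDr mulr_ge0// exprn_ge0// weight_ge0.
Qed.

(** Integration by parts in an arbitrary direction: the sum of the coordinate formulas with
    weights [v i]. *)
Lemma stein v G G' : dirder v G G' -> expect G' = expect (fun x => linear_form v x * G x).
Proof.
move=> [dG gG EG]; have [tG hG] := gG.
have -> : G' = (fun x => \sum_i v i * dG i x) by apply/funext.
have td i : tame (dG i) by have [] := hG i.
have tx i : tame (fun x => x i * G x) by apply: tameM => //; exact: tame_coord.
rewrite expect_sum; last by move=> k; exact: tameZ.
under eq_bigr => i _ do rewrite expectZ// (stein_coord i gG) -expectZ//.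
rewrite -expect_sum; last by move=> k; exact: tameZ.
congr expect; apply/funext => x; rewrite mulr_suml; apply: eq_bigr => i _.
by rewrite mulrA.
Qed.

End expectation.

(** * Polynomials: derivations and Gaussian mean squares *)
Section mpoly_derivation.
Context {R : realType} {n : nat}.
Implicit Types (p q : mpoly n R) (v u : 'I_n -> R).

Definition mder v p : mpoly n R := \sum_i v i *: mderiv i p.
Definition mlin v : mpoly n R := \sum_i v i *: mpolyX R (mnm1 i).

Lemma mderD v p q : mder v (p + q) = mder v p + mder v q.
Proof.
by rewrite /mder -big_split/=; apply: eq_bigr => i _; rewrite mderivD scalerDr.
Qed.

Lemma mderB v p q : mder v (p - q) = mder v p - mder v q.
Proof.
by rewrite /mder -sumrB; apply: eq_bigr => i _; rewrite mderivB scalerBr.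
Qed.

Lemma mderM v p q : mder v (p * q) = mder v p * q + p * mder v q.
Proof.
rewrite /mder mulr_suml mulr_sumr -big_split/=; apply: eq_bigr => i _.
by rewrite mderivM scalerDr -scalerAl -scalerAr.
Qed.

Lemma mderZ v c p : mder v (c *: p) = c *: mder v p.
Proof.
rewrite /mder scaler_sumr; apply: eq_bigr => i _.
by rewrite mderivZ !scalerA mulrC.
Qed.

Lemma mderC v c : mder v (mpolyC n c) = 0.
Proof. by rewrite /mder big1// => i _; rewrite mderivC scaler0. Qed.

Lemma mderX1 v i : mder v (mpolyX R (mnm1 i)) = mpolyC n (v i).
Proof.
rewrite /mder (bigD1 i)//= big1 ?addr0 => [|j ji].
  rewrite mderivX mnm1E eqxx scale1r.
  have -> : mnm_sub (mnm1 i) (mnm1 i) = mnm0 by apply/mnmP => j; rewrite mnmBE subnn mnm0E.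
  by rewrite mpolyX0 -mul_mpolyC mulr1.
by rewrite mderivX mnm1E eq_sym (negbTE ji) scale0r scaler0.
Qed.

Lemma mder_sum v (I : Type) (r : seq I) (F : I -> mpoly n R) :
  mder v (\sum_(k <- r) F k) = \sum_(k <- r) mder v (F k).
Proof.
elim: r => [|k r IH]; first by rewrite !big_nil -[0](mpolyC0 n R) mderC.
by rewrite !big_cons mderD IH.
Qed.

Lemma mder_lin v u : mder v (mlin u) = mpolyC n (\sum_i u i * v i).
Proof.
rewrite mder_sum raddf_sum/=; apply: eq_bigr => i _.
by rewrite mderZ mderX1 -mul_mpolyC -mpolyCM.
Qed.

Lemma meval_lin v x : meval x (mlin v) = linear_form v x.
Proof.
rewrite /mlin /linear_form raddf_sum/=; apply: eq_bigr => i _.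
by rewrite mevalZ mevalXU.
Qed.

(** Polynomials are generated by constants and variables, and the derivation rules of
    [dirder] and [mder] agree. *)
Lemma dirder_meval v p : dirder v (fun x => meval x p) (fun x => meval x (mder v p)).
Proof.
pose Q q := dirder v (fun x => meval x q) (fun x => meval x (mder v q)).
have QC c : Q (mpolyC n c).
  rewrite /Q mderC; under [X in dirder _ X _]funext do rewrite mevalC.
  by under [X in dirder _ _ X]funext do rewrite meval0; exact: dirder_cst.
have QD q r : Q q -> Q r -> Q (q + r).
  move=> hq hr; rewrite /Q mderD.
  under [X in dirder _ X _]funext do rewrite mevalD.
  by under [X in dirder _ _ X]funext do rewrite mevalD; exact: dirderD.
have QM q r : Q q -> Q r -> Q (q * r).
  move=> hq hr; rewrite /Q mderM.
  under [X in dirder _ X _]funext do rewrite mevalM.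
  by under [X in dirder _ _ X]funext do rewrite mevalD !mevalM; exact: dirderM.
have Q1 : Q 1 by rewrite -(mpolyC1 n R); exact: QC.
have QX i : Q (mpolyX R (mnm1 i)).
  rewrite /Q mderX1; under [X in dirder _ X _]funext do rewrite mevalXU.
  by under [X in dirder _ _ X]funext do rewrite mevalC; exact: dirder_coord.
have QXn i k : Q (mpolyX R (mnm1 i) ^+ k).
  by elim: k => [|k IH]; rewrite ?expr0// exprS; exact: QM.
rewrite (mpolyE p); elim: (msupp p) => [|m r IH].
  by rewrite big_nil -(mpolyC0 n R); exact: QC.
rewrite big_cons; apply: (QD _ _) => //; rewrite -mul_mpolyC; apply: (QM _ _) => //.
rewrite mpolyXE_id; elim: (index_enum _) => [|j s IHs]; first by rewrite big_nil.
by rewrite big_cons; exact: QM.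
Qed.

Lemma tame_meval p : tame (fun x => meval x p).
Proof. exact: (dirder_tame (dirder_meval (fun=> 0) p)).1. Qed.

Lemma msize_leP p k :
  reflect (forall m, mcoeff m p != 0 -> (mdeg m < k)%N) (mmeasure mdeg p <= k)%N.
Proof.
rewrite msizeE; apply: (iffP idP) => [h m|h].
  rewrite mcoeff_eq0 negbK => mp; apply: leq_trans h.
  exact: (@leq_bigmax_seq _ _ _ (fun m => (mdeg m).+1)).
by apply/bigmax_leqP_seq => m mp _; apply: h; rewrite mcoeff_eq0 negbK.
Qed.

Lemma mder_msize v p k : (mmeasure mdeg p <= k.+1)%N -> (mmeasure mdeg (mder v p) <= k)%N.
Proof.
move=> /msize_leP hp; apply/msize_leP => m; rewrite /mder raddf_sum/=.
apply: contraNltn => km; apply/eqP; rewrite big1// => i _.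
rewrite mcoeffZ mcoeff_mderiv.
have [->|/hp] := eqVneq (mcoeff (mnm_add m (mnm1 i)) p) 0; first by rewrite mul0rn mulr0.
by rewrite mdegD mdeg1 addn1 ltnS ltnNge km.
Qed.

Lemma mlin_msize v : (mmeasure mdeg (mlin v) <= 2)%N.
Proof.
apply/msize_leP => m; rewrite /mlin raddf_sum/=.
apply: contraNltn => km; apply/eqP; rewrite big1// => i _.
rewrite mcoeffZ mcoeffX; case: eqP => [e|]; last by rewrite mulr0.
by move: km; rewrite -e mdeg1.
Qed.

Lemma mlinM_msize v p k : (mmeasure mdeg p <= k.+1)%N ->
  (mmeasure mdeg (mlin v * p) <= k.+2)%N.
Proof.
move=> hp; have [->|p0] := eqVneq p 0; first by rewrite mulr0 mmeasure0.
have [->|l0] := eqVneq (mlin v) 0; first by rewrite mul0r mmeasure0.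
rewrite msizeM// -subn1 leq_subLR; exact: leq_add (mlin_msize v) hp.
Qed.

End mpoly_derivation.

Section hermite.
Context {disp : measure_display} {T : measurableType disp} {R : realType}.
Variables (P : probability T R) (n : nat) (Z : 'I_n -> {RV P >-> R}).
Hypothesis normalZ : standard_normal_vector P Z.
Variable v : 'I_n -> R.
Hypothesis v1 : \sum_i v i * v i = 1.
Implicit Types p q : mpoly n R.

Definition pmean p : R := expect Z (fun x => meval x p).

Lemma pmeanD p q : pmean (p + q) = pmean p + pmean q.
Proof.
rewrite /pmean; under [X in expect _ X]funext do rewrite mevalD.
by rewrite expectD//; exact: tame_meval.
Qed.

Lemma pmeanZ c p : pmean (c *: p) = c * pmean p.
Proof.
rewrite /pmean; under [X in expect _ X]funext do rewrite mevalZ.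
by rewrite expectZ//; exact: tame_meval.
Qed.

Lemma pmeanB p q : pmean (p - q) = pmean p - pmean q.
Proof. by rewrite pmeanD -[- q]scaleN1r pmeanZ mulN1r. Qed.

Lemma pmean_sqr_ge0 p : 0 <= pmean (p * p).
Proof.
apply: expect_ge0 => x; rewrite mevalM -expr2; exact: sqr_ge0.
Qed.

Lemma pmean_mder p : pmean (mder v p) = pmean (mlin v * p).
Proof.
rewrite /pmean (stein normalZ (dirder_meval v p)); congr expect; apply/funext => x.
by rewrite mevalM meval_lin.
Qed.

(** The adjoint of [mder v] for the Gaussian inner product, see [pmean_adjoint]. *)
Definition creation p : mpoly n R := mlin v * p - mder v p.

(** The canonical commutation relation. *)
Lemma mder_creation p : mder v (creation p) = p + creation (mder v p).
Proof.
by rewrite /creation mderB mderM mder_lin v1 mpolyC1 mul1r addrA.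
Qed.

Lemma pmean_adjoint p q : pmean (mder v p * q) = pmean (p * creation q).
Proof.
have -> : mder v p * q = mder v (p * q) - p * mder v q by rewrite mderM; ring.
rewrite pmeanB pmean_mder -pmeanB; congr pmean; rewrite /creation; ring.
Qed.

Lemma pmean_creation_sqr p :
  pmean (creation p * creation p) = pmean (p * p) + pmean (mder v p * mder v p).
Proof.
rewrite -pmean_adjoint mder_creation mulrDl pmeanD; congr (_ + _).
by rewrite mulrC -pmean_adjoint.
Qed.

(** Let [d] bound the degree of [p] and let [q = creation (mder v p)] be the number
    operator applied to [p].  The commutation relation and the induction hypothesis for
    [mder v p] give [|q|^2 <= d |D p|^2], while [|D p|^2 = <p, q>]; expanding
    [|d p - q|^2 >= 0] then yields [|D p|^2 <= d |p|^2]. *)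
Lemma pmean_mder_sqr_le d p : (mmeasure mdeg p <= d.+1)%N ->
  pmean (mder v p * mder v p) <= d%:R * pmean (p * p).
Proof.
elim: d p => [|d IH] p hp.
  have := mder_msize v hp; rewrite leqn0 mmeasure_poly_eq0 => /eqP ->.
  by rewrite mul0r mul0r -[0](scale0r 0) pmeanZ mul0r.
set q := creation (mder v p).
have hq : pmean (q * q) <= d.+1%:R * pmean (mder v p * mder v p).
  rewrite pmean_creation_sqr -addn1 natrD mulrDl mul1r addrC lerD2r.
  by apply: IH; exact: mder_msize.
have hb : pmean (p * q) = pmean (mder v p * mder v p) by rewrite -pmean_adjoint.
have := pmean_sqr_ge0 (d.+1%:R *: p - q).
have -> : (d.+1%:R *: p - q) * (d.+1%:R *: p - q)
    = (d.+1%:R * d.+1%:R) *: (p * p) - (2 * d.+1%:R) *: (p * q) + q * q.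
  by rewrite -!mul_mpolyC !mpolyCM; ring.
rewrite pmeanD pmeanB !pmeanZ hb => h.
have m0 : 0 < d.+1%:R :> R by rewrite ltr0n.
rewrite -(ler_pM2l m0); lra.
Qed.

(** Multiplication by the linear form is [creation + mder v], so the parallelogram inequality
    applies; likewise in the next lemma, for [creation - mder v]. *)
Lemma pmean_mlin_sqr_le d p : (mmeasure mdeg p <= d.+1)%N ->
  pmean ((mlin v * p) * (mlin v * p)) <= (4 * d%:R + 2) * pmean (p * p).
Proof.
move=> /pmean_mder_sqr_le; set D := mder v p => hD.
have hc := pmean_creation_sqr p; rewrite -/D in hc.
have := pmean_sqr_ge0 (creation p - D).
have -> : (creation p - D) * (creation p - D) =
  2 *: (creation p * creation p) + 2 *: (D * D) - (mlin v * p) * (mlin v * p).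
  by rewrite /creation -/D -!mul_mpolyC !rmorph_nat; ring.
rewrite pmeanB pmeanD !pmeanZ hc; lra.
Qed.

Lemma pmean_mlin_mder_sqr_le d p : (mmeasure mdeg p <= d.+1)%N ->
  pmean ((mlin v * p - 2 *: mder v p) * (mlin v * p - 2 *: mder v p))
   <= (4 * d%:R + 2) * pmean (p * p).
Proof.
move=> /pmean_mder_sqr_le; set D := mder v p => hD.
have hc := pmean_creation_sqr p; rewrite -/D in hc.
have := pmean_sqr_ge0 (creation p + D).
have -> : (creation p + D) * (creation p + D) =
  2 *: (creation p * creation p) + 2 *: (D * D)
   - (mlin v * p - 2 *: D) * (mlin v * p - 2 *: D).
  by rewrite /creation -/D -!mul_mpolyC !rmorph_nat; ring.
rewrite pmeanB pmeanD !pmeanZ hc; lra.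
Qed.

End hermite.

(** * Derivatives of some special compositions *)
Section dirder_special.
Context {R : realType} {n : nat}.
Implicit Types (v u : 'I_n -> R) (G H : ('I_n -> R) -> R).

Lemma dirder_ext v G G' H H' : (forall x, G x = H x) -> (forall x, G' x = H' x) ->
  dirder v G G' -> dirder v H H'.
Proof. by move=> /funext -> /funext ->. Qed.

Lemma dirderZ v c G G' : dirder v G G' -> dirder v (fun x => c * G x) (fun x => c * G' x).
Proof.
move=> dG; apply: dirder_ext (dirderM (dirder_cst v c) dG) => // x.
by rewrite mul0r add0r.
Qed.

Lemma dirderDc v c G G' : dirder v G G' -> dirder v (fun x => G x + c) G'.
Proof.
move=> dG; apply: dirder_ext (dirderD dG (dirder_cst v c)) => // x.
by rewrite addr0.
Qed.

Lemma dirderB v G H G' H' : dirder v G G' -> dirder v H H' ->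
  dirder v (fun x => G x - H x) (fun x => G' x - H' x).
Proof.
move=> dG dH; apply: dirder_ext (dirderD dG (dirderZ (-1) dH)) => x;
  by rewrite mulN1r.
Qed.

Lemma dirder_linear_form v u : dirder v (linear_form u) (fun=> \sum_i u i * v i).
Proof.
apply: dirder_ext (dirder_meval v (mlin u)) => x; first exact: meval_lin.
by rewrite mder_lin mevalC.
Qed.

Lemma dirder_sqr v G G' : dirder v G G' ->
  dirder v (fun x => G x ^+ 2) (fun x => 2 * G x * G' x).
Proof.
move=> dG; apply: dirder_ext (dirderM dG dG) => x; first by rewrite expr2.
by ring.
Qed.

Lemma norm_atan_le2 (t : R) : `|atan t| <= 2.
Proof.
have h := ltW (pihalf_lt2 R); rewrite ler_norml; apply/andP; split.
  by apply: le_trans (ltW (atan_gtNpi2 _)); rewrite lerN2.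
exact: le_trans (ltW (atan_ltpi2 _)) _.
Qed.

Lemma dirder_atan v G G' : dirder v G G' ->
  dirder v (fun x => atan (G x)) (fun x => (1 + G x ^+ 2)^-1 * G' x).
Proof.
move=> dG; apply: (dirder_comp (f := atan) (f' := fun t => (1 + t ^+ 2)^-1) dG).
- by apply: continuous_measurable_fun => x; exact: continuous_atan.
- by apply: continuous_measurable_fun; exact: continuous_oneDsqrV.
- by move=> x; exact: continuous_oneDsqrV.
- apply: (@bounded_poly_growth _ _ _ (pi / 2)) => x /=; rewrite ler_norml.
  by rewrite (ltW (atan_gtNpi2 _)) (ltW (atan_ltpi2 _)).
- apply: (@bounded_poly_growth _ _ _ 1) => x /=.
  have h : 0 <= 1 + G x ^+ 2 by rewrite addr_ge0// sqr_ge0.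
  rewrite ger0_norm ?invr_ge0// invf_le1 ?lerDl ?sqr_ge0//.
  by rewrite ltr_pwDl// sqr_ge0.
Qed.

Lemma dirder_powR v (s e : R) G G' : 0 < e -> (forall x, e <= G x) -> s <= 0 ->
  dirder v G G' ->
  dirder v (fun x => G x `^ s) (fun x => s * G x `^ (s - 1) * G' x).
Proof.
move=> e0 eG s0 dG.
have G0 x : 0 < G x by exact: lt_le_trans (eG x).
have bnd (r : R) x : r <= 0 -> `|G x `^ r| <= e `^ r.
  move=> r0; rewrite ger0_norm ?powR_ge0// -[r]opprK (powRN _ (- r)) (powRN e (- r)).
  rewrite lef_pV2 ?posrE ?powR_gt0//.
  have r'0 : 0 <= - r by rewrite oppr_ge0.
  by apply: (ge0_ler_powR r'0 _ _ (eG x)); rewrite nnegrE ltW.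
have d x : is_derive (G x) 1 (fun t : R => t `^ s) (s * G x `^ (s - 1)).
  exact: is_derive1_powR.
refine (@dirder_comp _ _ v (fun t : R => t `^ s) (fun t => s * t `^ (s - 1)) G G' dG _ _ d _ _ _).
- exact: measurable_powR.
- by apply: measurable_funM => //; exact: measurable_powR.
- move=> x; apply: cvgM; first exact: cvg_cst.
  exact: (is_derive_continuous (is_derive1_powR (s - 1) (G0 x))).
- by apply: (@bounded_poly_growth _ _ _ (e `^ s)) => x; exact: bnd.
- apply: (@bounded_poly_growth _ _ _ (`|s| * e `^ (s - 1))) => x /=.
  rewrite normrM; apply: ler_wpM2l => //; apply: bnd.
  by rewrite subr_le0 (le_trans s0).
Qed.

Lemma dirder_inv v (e : R) G G' : 0 < e -> (forall x, e <= G x) ->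
  dirder v G G' ->
  dirder v (fun x => (G x)^-1) (fun x => - (G x)^-1 ^+ 2 * G' x).
Proof.
move=> e0 eG dG; have G0 x : 0 < G x by exact: lt_le_trans (eG x).
apply: dirder_ext (dirder_powR e0 eG (lerN10 _) dG) => x.
  by rewrite powR_inv1// ltW.
rewrite mulN1r (_ : -1 - 1 = - 2%:R) ?powR_invn ?exprVn ?ltW//; by ring.
Qed.

(** The reciprocal square root. *)
Definition rsqrt (t : R) := t `^ (- 2^-1).

Lemma rsqrt_gt0 t : 0 < t -> 0 < rsqrt t.
Proof. exact: powR_gt0. Qed.

Lemma rsqrt_sqr t : 0 < t -> rsqrt t ^+ 2 = t^-1.
Proof.
move=> t0; have tn : t != 0 by rewrite gt_eqF.
have -> : t^-1 = t `^ (- 2^-1 + - 2^-1).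
  by rewrite (_ : - 2^-1 + - 2^-1 = -1) ?powR_inv1 ?ltW//; lra.
by rewrite powRD ?tn ?implybT// expr2.
Qed.

Lemma dirder_rsqrt v (e : R) G G' : 0 < e -> (forall x, e <= G x) ->
  dirder v G G' ->
  dirder v (fun x => rsqrt (G x))
    (fun x => - 2^-1 * (rsqrt (G x) * (G x)^-1) * G' x).
Proof.
move=> e0 eG dG; have G0 x : 0 < G x by exact: lt_le_trans (eG x).
have h : - 2^-1 <= 0 :> R by rewrite oppr_le0 invr_ge0.
apply: dirder_ext (dirder_powR e0 eG h dG) => x //.
have gn : G x != 0 by rewrite gt_eqF.
by rewrite powRD ?gn ?implybT// powR_inv1// ltW.
Qed.

Lemma lipschitz_antiderivative (F phi : R -> R) :
  (forall t : R, is_derive t 1 F (phi t)) -> (forall t, `|phi t| <= 1) ->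
  forall s t, `|F s - F t| <= `|s - t|.
Proof.
move=> dF p1.
suff h s t : t < s -> `|F s - F t| <= `|s - t|.
  move=> s t; have [ts|st|->] := ltgtP t s; first exact: h.
    by rewrite distrC [leRHS]distrC; exact: h.
  by rewrite !subrr.
move=> ts; have [] := @MVT _ F phi t s ts.
- by apply: continuous_subspaceT => x; exact: is_derive_continuous (dF x).
- move=> c _ ->; rewrite normrM ler_piMl//.
Qed.

Lemma dirder_antiderivative v (F phi : R -> R) G G' :
  (forall t : R, is_derive t 1 F (phi t)) -> (forall t, `|phi t| <= 1) ->
  continuous phi -> dirder v G G' ->
  dirder v (fun x => F (G x)) (fun x => phi (G x) * G' x).
Proof.
move=> dF p1 cphi dG; apply: (dirder_comp (f := F) (f' := phi) dG) => //.
- by apply: continuous_measurable_fun => x; exact: is_derive_continuous (dF x).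
- exact: continuous_measurable_fun.
- by move=> x; exact: cphi.
- have [_ gr] := tameD (tame_cst `|F 0|) (tame_norm (dirder_tame dG).1).
  have [C' [m' [C'0 hC']]] := gr; exists C', m'; split => // x.
  apply: le_trans (hC' x); apply: le_trans (ler_norm _) => /=.
  have := lipschitz_antiderivative dF p1 (G x) 0; rewrite subr0 => h.
  have -> : F (G x) = F 0 + (F (G x) - F 0) by ring.
  by apply: le_trans (ler_normD _ _) _; rewrite lerD2l.
- by apply: (@bounded_poly_growth _ _ _ 1) => x /=.
Qed.

End dirder_special.

(** * Weights that are derivatives of bounded functions *)
Section weighted.
Context {disp : measure_display} {T : measurableType disp} {R : realType}.
Variables (P : probability T R) (n : nat) (Z : 'I_n -> {RV P >-> R}).
Hypothesis normalZ : standard_normal_vector P Z.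
Implicit Types (v : 'I_n -> R) (p : mpoly n R) (W N : ('I_n -> R) -> R).
Local Notation E := (expect Z).
Local Notation mean := (pmean Z).

Lemma young_weighted (w N p s t : R) : 0 < t -> `|w| <= N ->
  w * p * s <= 2^-1 * (t * (N * p ^+ 2) + t^-1 * (N * s ^+ 2)).
Proof.
move=> t0 wN; have ti : 0 < t^-1 by rewrite invr_gt0.
have tt : t * t^-1 = 1 by rewrite mulfV// gt_eqF.
set i := t^-1 in ti tt *.
have h1 : 0 <= i * (t * p - s) ^+ 2 by rewrite mulr_ge0 ?sqr_ge0// ltW.
have h2 : 0 <= i * (t * p + s) ^+ 2 by rewrite mulr_ge0 ?sqr_ge0// ltW.
have e1 : i * (t * p - s) ^+ 2 = t * p ^+ 2 + i * s ^+ 2 - 2 * (p * s).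
  transitivity ((t * i) * (t * p ^+ 2) + i * s ^+ 2 - 2 * (t * i) * (p * s)); first ring.
  by rewrite tt; ring.
have e2 : i * (t * p + s) ^+ 2 = t * p ^+ 2 + i * s ^+ 2 + 2 * (p * s).
  transitivity ((t * i) * (t * p ^+ 2) + i * s ^+ 2 + 2 * (t * i) * (p * s)); first ring.
  by rewrite tt; ring.
rewrite e1 in h1; rewrite e2 in h2; clear e1 e2.
set Q := t * p ^+ 2 + i * s ^+ 2 in h1 h2.
have -> : t * (N * p ^+ 2) + i * (N * s ^+ 2) = N * Q by rewrite /Q; ring.
rewrite -mulrA; set b := p * s in h1 h2 *.
move: wN; rewrite ler_norml => /andP[]; nra.
Qed.

(** Integration by parts turns [W' * p^2] into [W * p * twist v p]. *)
Definition twist v p : mpoly n R := mlin v * p - 2 *: mder v p.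

Lemma weighted_sqr_le v W W' N p t : dirder v W W' -> tame N ->
  (forall x, `|W x| <= N x) -> 0 < t ->
  E (fun x => W' x * meval x p ^+ 2) <=
    2^-1 * (t * E (fun x => N x * meval x p ^+ 2)
            + t^-1 * E (fun x => N x * meval x (twist v p) ^+ 2)).
Proof.
move=> dW tN WN t0; set s := twist v p.
have [tW tW'] := dirder_tame dW.
have tp q : tame (fun x => meval x q ^+ 2).
  by apply: tameX; exact: tame_meval.
have tl := tame_linear_form v.
have tpp q : tame (fun x => meval x q) := tame_meval q.
have h := stein normalZ (dirderM dW (dirder_meval v (p * p))).
have -> : E (fun x => W' x * meval x p ^+ 2) = E (fun x => W x * meval x p * meval x s).
  have -> : E (fun x => W' x * meval x p ^+ 2) =
      E (fun x => (W' x * meval x (p * p) + W x * meval x (mder v (p * p)))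
        - W x * meval x (mder v (p * p))).
    by congr E; apply/funext => x; rewrite mevalM expr2; ring.
  rewrite expectB//; [|by apply: tameD; exact: tameM|exact: tameM].
  rewrite h -expectB//; [|by apply: tameM => //; exact: tameM|exact: tameM].
  congr E; apply/funext => x; rewrite /s /twist mderM mevalB mevalD !mevalM mevalZ meval_lin.
  by ring.
have tNp q : tame (fun x => N x * meval x q ^+ 2) by exact: tameM.
rewrite -!expectZ// -expectD//; [|exact: tameZ|exact: tameZ].
rewrite -expectZ//; last by apply: tameD; exact: tameZ.
apply: expect_le => //.
- by apply: tameM => //; exact: tameM.
- by apply: tameZ; apply: tameD; exact: tameZ.
- by move=> x; exact: young_weighted.
Qed.

Lemma expect_meval_sqr p : E (fun x => meval x p ^+ 2) = mean (p * p).
Proof. by congr E; apply/funext => x; rewrite mevalM expr2. Qed.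

(** The constant comes from Young's inequality with parameter [d + 1], since
    [(4 d + 2) / (d + 1) <= 4].  What matters is that it does not see the size of the
    weight [W'], only a bound on [W]. *)
Lemma bounded_weight_sqr_le v W W' M p d : \sum_i v i * v i = 1 ->
  dirder v W W' -> (forall x, `|W x| <= M) -> (mmeasure mdeg p <= d.+1)%N ->
  E (fun x => W' x * meval x p ^+ 2) <= M * ((d%:R + 5) / 2) * mean (p * p).
Proof.
move=> v1 dW WM hp.
have M0 : 0 <= M by exact: le_trans (WM (fun=> 0)).
have d0 : 0 < d%:R + 1 :> R by rewrite ltr_wpDl.
apply: le_trans (weighted_sqr_le (N := fun=> M) p dW (tame_cst _) WM d0) _.
have t2 q : tame (fun x => meval x q ^+ 2) by apply: tameX; exact: tame_meval.
rewrite !expectZ// !expect_meval_sqr.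
have := pmean_mlin_mder_sqr_le normalZ v1 hp.
set s2 := mean (_ * _); set p2 := mean (p * p) => hs.
have p20 : 0 <= p2 by exact: pmean_sqr_ge0.
have hs4 : (d%:R + 1)^-1 * s2 <= 4 * p2.
  rewrite ler_pdivrMl//; apply: le_trans hs _.
  have : 0 <= d%:R * p2 by rewrite mulr_ge0.
  lra.
have := ler_wpM2l M0 hs4.
have -> : M * ((d%:R + 1)^-1 * s2) = (d%:R + 1)^-1 * (M * s2) by ring.
lra.
Qed.

(** Turns the quadratic estimates for a weight into linear ones. *)
Lemma weight_norm_le (w : ('I_n -> R) -> R) p (a b t : R) : tame w ->
  0 < t -> (forall x, 0 <= w x) -> E w <= a -> E (fun x => w x * meval x p ^+ 2) <= b ->
  E (fun x => w x * `|meval x p|) <= 2^-1 * (t * a + t^-1 * b).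
Proof.
move=> tw t0 w0 wa wb.
have tp : tame (fun x => meval x p) := tame_meval p.
have t1 : tame (fun x => w x * meval x p ^+ 2) by apply: tameM => //; exact: tameX.
apply: (@le_trans _ _ (2^-1 * (t * E w + t^-1 * E (fun x => w x * meval x p ^+ 2)))).
  rewrite -!expectZ// -expectD//; [|exact: tameZ|exact: tameZ].
  rewrite -expectZ//; last by apply: tameD; exact: tameZ.
  apply: expect_le => //.
  - by apply: tameM => //; exact: tame_norm.
  - by apply: tameZ; apply: tameD; exact: tameZ.
  move=> x; have := @young_weighted (w x) (w x) 1 `|meval x p| t t0.
  rewrite ger0_norm// lexx mulr1 expr1n mulr1 => /(_ isT).
  by rewrite -normrX (ger0_norm (sqr_ge0 _)).
have ti : 0 < t^-1 by rewrite invr_gt0.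
apply: ler_wpM2l => //; apply: lerD; apply: ler_wpM2l => //; exact: ltW.
Qed.

End weighted.

(** * The regularized radial field in a plane of two eigenvectors *)
Section plane.
Context {R : realType} {n : nat}.
Implicit Types (v u : 'I_n -> R).

Definition affine (a c : R) v x : R := a * linear_form v x + c.

Lemma dirder_affine u (a c : R) v :
  dirder u (affine a c v) (fun=> a * \sum_i v i * u i).
Proof. by apply: dirderDc; apply: dirderZ; exact: dirder_linear_form. Qed.

Variables (v u : 'I_n -> R) (a b c e eta : R).
Hypotheses (v1 : \sum_i v i * v i = 1) (u1 : \sum_i u i * u i = 1).
Hypothesis vu : \sum_i v i * u i = 0.
Hypotheses (a0 : 0 < a) (b0 : 0 < b) (eta0 : 0 < eta).

Local Notation Y := (affine a c v).
Local Notation U := (affine b e u).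

Definition width x : R := Y x ^+ 2 + eta ^+ 2.
Definition sqradius x : R := Y x ^+ 2 + U x ^+ 2 + eta ^+ 2.
Definition angle x : R := atan (U x * rsqrt (width x)).
Definition angle' x : R := b * (rsqrt (width x) * width x) / sqradius x.
(** Up to the factor [a], the derivative of the bounded function [Y / sqrt width], see
    [dirder_profile]. *)
Definition slope x : R := eta ^+ 2 * (rsqrt (width x) * (width x)^-1).
(** The component along [v]; the component along [u] is obtained by exchanging the roles of
    [(v, a, c)] and [(u, b, e)]. *)
Definition radial_field x : R := Y x / (2 * a * sqradius x).
(** The divergence of the field: by [dirder_radial_field] its two partial derivatives add up
    to [1 / q - (Y^2 + U^2) / q^2] with [q = sqradius]. *)
Definition radial_div x : R := eta ^+ 2 / sqradius x ^+ 2.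

Lemma eta2_gt0 : 0 < eta ^+ 2. Proof. exact: exprn_gt0. Qed.

Lemma width_ge x : eta ^+ 2 <= width x.
Proof. by rewrite /width lerDr sqr_ge0. Qed.

Lemma width_gt0 x : 0 < width x.
Proof. exact: lt_le_trans eta2_gt0 (width_ge x). Qed.

Lemma width_le_sqradius x : width x <= sqradius x.
Proof. by rewrite /width /sqradius -addrA lerD2l lerDr sqr_ge0. Qed.

Lemma sqradius_ge x : eta ^+ 2 <= sqradius x.
Proof. exact: le_trans (width_ge x) (width_le_sqradius x). Qed.

Lemma sqradius_gt0 x : 0 < sqradius x.
Proof. exact: lt_le_trans (width_gt0 x) (width_le_sqradius x). Qed.

Lemma dirder_Y_v : dirder v Y (fun=> a).
Proof. by apply: dirder_ext (dirder_affine v a c v) => // x; rewrite v1 mulr1. Qed.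

Lemma dirder_Y_u : dirder u Y (fun=> 0).
Proof. by apply: dirder_ext (dirder_affine u a c v) => // x; rewrite vu mulr0. Qed.

Lemma dirder_U_u : dirder u U (fun=> b).
Proof. by apply: dirder_ext (dirder_affine u b e u) => // x; rewrite u1 mulr1. Qed.

Lemma dirder_U_v : dirder v U (fun=> 0).
Proof.
apply: dirder_ext (dirder_affine v b e u) => // x.
by rewrite (eq_bigr (fun i => v i * u i)) ?vu ?mulr0// => i _; exact: mulrC.
Qed.

Lemma dirder_width_u : dirder u width (fun=> 0).
Proof.
apply: dirder_ext (dirderDc (eta ^+ 2) (dirder_sqr dirder_Y_u)) => // x.
by rewrite mulr0.
Qed.

Lemma dirder_width_v : dirder v width (fun x => 2 * Y x * a).
Proof. exact: dirderDc (dirder_sqr dirder_Y_v). Qed.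

Lemma dirder_sqradius_v : dirder v sqradius (fun x => 2 * Y x * a).
Proof.
apply: dirder_ext (dirderDc (eta ^+ 2)
  (dirderD (dirder_sqr dirder_Y_v) (dirder_sqr dirder_U_v))) => // x.
by rewrite mulr0 addr0.
Qed.

Lemma dirder_rsqrt_width_u : dirder u (fun x => rsqrt (width x)) (fun=> 0).
Proof.
apply: dirder_ext (dirder_rsqrt eta2_gt0 width_ge dirder_width_u) => // x.
by rewrite mulr0.
Qed.

Lemma dirder_slope_u : dirder u slope (fun=> 0).
Proof.
apply: dirder_ext (dirderZ (eta ^+ 2) (dirderM dirder_rsqrt_width_u
  (dirder_inv eta2_gt0 width_ge dirder_width_u))) => // x.
by rewrite !(mulr0, mul0r, addr0).
Qed.

Lemma dirder_angle : dirder u angle angle'.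
Proof.
apply: dirder_ext (dirder_atan (dirderM dirder_U_u dirder_rsqrt_width_u)) => // x.
have A0 := width_gt0 x; have Q0 := sqradius_gt0 x.
have rE : sqradius x = width x + U x ^+ 2 by rewrite /sqradius /width; ring.
rewrite /angle' exprMn rsqrt_sqr// mulr0 addr0.
have -> : 1 + U x ^+ 2 * (width x)^-1 = sqradius x / width x.
  by rewrite rE; field; rewrite gt_eqF.
by rewrite invf_div; field; rewrite !gt_eqF.
Qed.

Lemma dirder_profile : dirder v (fun x => Y x * rsqrt (width x)) (fun x => a * slope x).
Proof.
apply: dirder_ext (dirderM dirder_Y_v
  (dirder_rsqrt eta2_gt0 width_ge dirder_width_v)) => // x.
have A0 := width_gt0 x.
have eE : eta ^+ 2 = width x - Y x ^+ 2 by rewrite /width; ring.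
by rewrite /slope eE; field; rewrite gt_eqF.
Qed.

Lemma dirder_radial_field : dirder v radial_field
  (fun x => 2^-1 * ((sqradius x)^-1 - 2 * Y x ^+ 2 / sqradius x ^+ 2)).
Proof.
apply: dirder_ext (dirderZ ((2 * a)^-1) (dirderM dirder_Y_v
  (dirder_inv eta2_gt0 sqradius_ge dirder_sqradius_v))) => x.
  have Q0 := sqradius_gt0 x; rewrite /radial_field; field; by rewrite !gt_eqF.
have Q0 := sqradius_gt0 x; field; by rewrite !gt_eqF.
Qed.

Lemma angle_le2 x : `|angle x| <= 2.
Proof. exact: norm_atan_le2. Qed.

Lemma slope_gt0 x : 0 < slope x.
Proof.
have A0 := width_gt0 x; rewrite !mulr_gt0 ?invr_gt0 ?rsqrt_gt0//.
Qed.

Lemma profile_le1 x : `|Y x * rsqrt (width x)| <= 1.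
Proof.
have A0 := width_gt0 x; rewrite -(@expr_le1 _ 2)// -normrX ger0_norm ?sqr_ge0//.
rewrite exprMn rsqrt_sqr// ler_pdivrMr// mul1r /width lerDl sqr_ge0//.
Qed.

(** [angle'] is [b * sqrt width / sqradius], and [|Y| <= sqrt width]. *)
Lemma angle'_ge x : b * `|Y x| / sqradius x <= angle' x.
Proof.
have A0 := width_gt0 x; have Q0 := sqradius_gt0 x.
rewrite /angle' ler_pM2r ?invr_gt0// ler_pM2l//.
have r0 := rsqrt_gt0 A0.
have := profile_le1 x; rewrite normrM (gtr0_norm r0) => h.
have -> : rsqrt (width x) * width x = (rsqrt (width x))^-1.
  have rn : rsqrt (width x) != 0 by rewrite gt_eqF.
  apply: (mulfI rn); rewrite mulfV// mulrA -expr2 rsqrt_sqr// mulVf//.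
  by rewrite gt_eqF.
by rewrite -[leRHS]mul1r ler_pdivlMr.
Qed.

Lemma angle'_ge0 x : 0 <= angle' x.
Proof.
apply: le_trans (angle'_ge x); rewrite divr_ge0 ?mulr_ge0//; apply: ltW => //.
exact: sqradius_gt0.
Qed.

Lemma radial_field_le x : `|radial_field x| <= (2 * a * b)^-1 * angle' x.
Proof.
have Q0 := sqradius_gt0 x; have := angle'_ge x.
have k0 : 0 < 2 * a * b by rewrite !mulr_gt0.
rewrite -(ler_pM2l (_ : 0 < (2 * a * b)^-1)) ?invr_gt0//; apply: le_trans.
rewrite /radial_field normrM normfV (gtr0_norm (_ : 0 < 2 * a * sqradius x)) ?mulr_gt0//.
by rewrite le_eqVlt; apply/orP; left; apply/eqP; field; rewrite !gt_eqF.
Qed.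

(** One factor [1 / sqradius] is enlarged to [1 / width], which makes the bound a product of
    a derivative in the direction [u] and a function of [Y] alone that is a derivative in
    the direction [v]. *)
Lemma radial_div_le x : radial_div x <= b^-1 * (slope x * angle' x).
Proof.
have A0 := width_gt0 x; have Q0 := sqradius_gt0 x.
have -> : b^-1 * (slope x * angle' x) = eta ^+ 2 * rsqrt (width x) ^+ 2 / sqradius x.
  by rewrite /slope /angle'; field; rewrite !gt_eqF.
rewrite rsqrt_sqr// /radial_div -mulrA ler_pM2l ?eta2_gt0// expr2 invfM.
by rewrite ler_pM2r ?invr_gt0// lef_pV2 ?posrE// width_le_sqradius.
Qed.

Lemma radial_div_ge0 x : 0 <= radial_div x.
Proof. by rewrite divr_ge0// ?sqr_ge0// exprn_ge0// ltW// sqradius_gt0. Qed.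

End plane.

(** * Expectations against the field and its divergence *)
Section bounds.
Context {disp : measure_display} {T : measurableType disp} {R : realType}.
Variables (P : probability T R) (n : nat) (Z : 'I_n -> {RV P >-> R}).
Hypothesis normalZ : standard_normal_vector P Z.
Implicit Types (p : mpoly n R).
Local Notation E := (expect Z).
Local Notation mean := (pmean Z).

Lemma pmean1 : mean (1 * 1) = 1.
Proof.
rewrite mul1r /pmean; under [X in E X]funext do rewrite meval1.
exact: expect_cst.
Qed.

Lemma msizeD_le p q d : (mmeasure mdeg p <= d)%N -> (mmeasure mdeg q <= d)%N ->
  (mmeasure mdeg (p + q) <= d)%N.
Proof.
move=> hp hq; apply: leq_trans (mmeasureD_le _ _ _) _.
by rewrite geq_max hp.
Qed.

Lemma msize_scale_le c p d : (mmeasure mdeg p <= d)%N -> (mmeasure mdeg (c *: p) <= d)%N.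
Proof. exact: leq_trans (msizeZ_le _ _). Qed.

Lemma twist_msize v p d : (mmeasure mdeg p <= d.+1)%N ->
  (mmeasure mdeg (twist v p) <= d.+2)%N.
Proof.
move=> hp; apply: msizeD_le; first exact: mlinM_msize.
rewrite -scaleNr; apply: msize_scale_le.
by apply: leq_trans (mder_msize v hp) _; apply: (@leq_trans d.+1).
Qed.

Section plane_bounds.
Variables (v u : 'I_n -> R) (a b c e eta : R).
Hypotheses (v1 : \sum_i v i * v i = 1) (u1 : \sum_i u i * u i = 1).
Hypothesis vu : \sum_i v i * u i = 0.
Hypotheses (a0 : 0 < a) (b0 : 0 < b) (eta0 : 0 < eta).

Local Notation slope := (slope v a c eta).
Local Notation angle := (angle v u a b c e eta).
Local Notation angle' := (angle' v u a b c e eta).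
Local Notation radial_div := (radial_div v u a b c e eta).
Local Notation radial_field := (radial_field v u a b c e eta).

Lemma tame_slope : tame slope.
Proof. exact: (dirder_tame (dirder_slope_u a c vu eta0)).1. Qed.

Lemma tame_angle' : tame angle'.
Proof. exact: (dirder_tame (dirder_angle a b c e u1 vu eta0)).2. Qed.

Lemma tame_sqradius_inv : tame (fun x => (sqradius v u a b c e eta x)^-1).
Proof.
have dr := dirder_inv (eta2_gt0 eta0) (sqradius_ge v u a b c e eta)
  (dirder_sqradius_v a b c e eta v1 vu).
exact: (dirder_tame dr).1.
Qed.

Lemma tame_radial_div : tame radial_div.
Proof.
apply: tameZ; under [X in tame X]funext do rewrite -exprVn.
by apply: tameX; exact: tame_sqradius_inv.
Qed.

Lemma expect_angle'_sqr_le p d : (mmeasure mdeg p <= d.+1)%N ->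
  E (fun x => (2 * a * b)^-1 * angle' x * meval x p ^+ 2)
    <= (a * b)^-1 * ((d%:R + 5) / 2) * mean (p * p).
Proof.
move=> hp; apply: (bounded_weight_sqr_le normalZ u1
  (dirderZ _ (dirder_angle a b c e u1 vu eta0)) _ hp) => x.
have k0 : 0 < (2 * a * b)^-1 by rewrite invr_gt0 !mulr_gt0.
rewrite normrM (gtr0_norm k0).
apply: (@le_trans _ _ ((2 * a * b)^-1 * 2)).
  by rewrite ler_pM2l// angle_le2.
by rewrite le_eqVlt; apply/orP; left; apply/eqP; field; rewrite !gt_eqF.
Qed.

Lemma expect_radial_field_norm_le p d t N : (mmeasure mdeg p <= d.+1)%N -> 0 < t ->
  mean (p * p) <= N ->
  E (fun x => `|radial_field x| * `|meval x p|) <=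
    (a * b)^-1 * (2^-1 * (t * (5 / 2) + t^-1 * ((d%:R + 5) / 2 * N))).
Proof.
move=> hp t0 hN.
have tw : tame (fun x => (2 * a * b)^-1 * angle' x) by apply: tameZ; exact: tame_angle'.
have k0 : 0 <= (2 * a * b)^-1 by rewrite invr_ge0 !mulr_ge0// ltW.
have ab0 : 0 <= (a * b)^-1 by rewrite invr_ge0 mulr_ge0// ltW.
have d0 : 0 <= (d%:R + 5) / 2 :> R by rewrite divr_ge0// addr_ge0.
apply: (@le_trans _ _ (E (fun x => (2 * a * b)^-1 * angle' x * `|meval x p|))).
  apply: expect_le => //.
  - apply: tameM; apply: tame_norm; last exact: tame_meval.
    exact: (dirder_tame (dirder_radial_field b c e v1 vu a0 eta0)).1.
  - by apply: tameM => //; apply: tame_norm; exact: tame_meval.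
  - by move=> x; apply: ler_wpM2r => //; exact: radial_field_le.
have h1 : E (fun x => (2 * a * b)^-1 * angle' x) <= (a * b)^-1 * (5 / 2).
  have := @expect_angle'_sqr_le 1 0; rewrite mmeasure1 pmean1 mulr1 add0r => /(_ isT).
  by under [X in E X]funext do rewrite meval1 expr1n mulr1.
have h2 : E (fun x => (2 * a * b)^-1 * angle' x * meval x p ^+ 2)
    <= (a * b)^-1 * ((d%:R + 5) / 2 * N).
  apply: le_trans (expect_angle'_sqr_le hp) _; rewrite -mulrA.
  by apply: ler_wpM2l => //; exact: ler_wpM2l.
apply: le_trans (weight_norm_le normalZ tw t0 _ h1 h2) _.
  by move=> x; apply: mulr_ge0 => //; exact: angle'_ge0.
by rewrite le_eqVlt; apply/orP; left; apply/eqP; ring.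
Qed.

Lemma expect_slope_sqr_le p d : (mmeasure mdeg p <= d.+1)%N ->
  E (fun x => slope x * meval x p ^+ 2) <= a^-1 * ((d%:R + 5) / 2 * mean (p * p)).
Proof.
move=> hp; have := bounded_weight_sqr_le normalZ v1 (dirder_profile a c v1 eta0)
  (profile_le1 v a c eta0) hp.
have -> : E (fun x => a * slope x * meval x p ^+ 2) =
    a * E (fun x => slope x * meval x p ^+ 2).
  rewrite -expectZ//; last by apply: tameM; [exact: tame_slope|apply: tameX; exact: tame_meval].
  by congr E; apply/funext => x; rewrite mulrA.
by rewrite mul1r ler_pdivlMl.
Qed.

(** Two integrations by parts: the first, along [u], replaces [angle'] by the bounded [angle]
    and leaves the weight [slope], which the second one, along [v], removes. *)
Lemma expect_radial_div_sqr_le p d t : (mmeasure mdeg p <= d.+1)%N -> 0 < t ->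
  E (fun x => radial_div x * meval x p ^+ 2) <= (a * b)^-1 *
    (t * ((d%:R + 5) / 2) + t^-1 * ((d%:R + 6) / 2 * (4 * d%:R + 2))) * mean (p * p).
Proof.
move=> hp t0; have tk := tame_slope; have ta := tame_angle'.
have tq q : tame (fun x => meval x q ^+ 2) by apply: tameX; exact: tame_meval.
have td := dirderM (dirder_slope_u a c vu eta0) (dirder_angle a b c e u1 vu eta0).
have W x : `|slope x * angle x| <= 2 * slope x.
  have k0 := slope_gt0 v a c eta0 x.
  by rewrite normrM (gtr0_norm k0) mulrC ler_pM2r// angle_le2.
have t2k : tame (fun x => 2 * slope x) by exact: tameZ.
have h := weighted_sqr_le normalZ p td t2k W t0.
have two q : E (fun x => 2 * slope x * meval x q ^+ 2) = 2 * E (fun x => slope x * meval x q ^+ 2).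
  rewrite -expectZ//; last exact: tameM.
  by congr E; apply/funext => x; rewrite mulrA.
rewrite !two in h.
have h1 := expect_slope_sqr_le hp.
have h2 := expect_slope_sqr_le (twist_msize u hp).
have h3 := pmean_mlin_mder_sqr_le normalZ u1 hp; rewrite -/(twist u p) in h3.
set s2 := mean (twist u p * twist u p) in h2 h3.
have p0 : 0 <= mean (p * p) by exact: pmean_sqr_ge0.
have ai : 0 < a^-1 by rewrite invr_gt0.
have bi : 0 < b^-1 by rewrite invr_gt0.
have ti : 0 < t^-1 by rewrite invr_gt0.
have tdiv := tame_radial_div.
apply: (@le_trans _ _ (b^-1 * E (fun x => (0 * angle x + slope x * angle' x) * meval x p ^+ 2))).
  rewrite -(expectZ normalZ); last first.
    by apply: tameM => //; exact: (dirder_tame td).2.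
  apply: (expect_le normalZ).
  - exact: tameM.
  - by apply: tameZ; apply: tameM => //; exact: (dirder_tame td).2.
  move=> x; rewrite mulrA mul0r add0r; apply: ler_wpM2r; first exact: sqr_ge0.
  exact: radial_div_le.
rewrite invfM [a^-1 * _]mulrC -!mulrA; apply: ler_wpM2l; first exact: ltW.
apply: le_trans h _.
have g1 := ler_wpM2l (ltW t0) h1.
have d6 : 0 <= (d%:R + 6) / 2 :> R by rewrite divr_ge0// addr_ge0.
have d6E : d.+1%:R + 5 = d%:R + 6 :> R by rewrite -natr1; ring.
rewrite d6E in h2.
have h4 := le_trans h2 (ler_wpM2l (ltW ai) (ler_wpM2l d6 h3)).
have g2 := ler_wpM2l (ltW ti) h4.
have -> : 2^-1 * (t * (2 * E (fun x => slope x * meval x p ^+ 2)) +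
   t^-1 * (2 * E (fun x => slope x * meval x (twist u p) ^+ 2)))
  = t * E (fun x => slope x * meval x p ^+ 2) +
    t^-1 * E (fun x => slope x * meval x (twist u p) ^+ 2) by field; rewrite gt_eqF.
apply: le_trans (lerD g1 g2) _.
by rewrite le_eqVlt; apply/orP; left; apply/eqP; ring.
Qed.

Lemma expect_radial_div_norm_le p d s t N : (mmeasure mdeg p <= d.+1)%N -> 0 < s -> 0 < t ->
  mean (p * p) <= N ->
  E (fun x => radial_div x * `|meval x p|) <= (a * b)^-1 * (2^-1 * (t * (17 / 2) +
    t^-1 * ((s * ((d%:R + 5) / 2) + s^-1 * ((d%:R + 6) / 2 * (4 * d%:R + 2))) * N))).
Proof.
move=> hp s0 t0 hN.
have ab0 : 0 <= (a * b)^-1 by rewrite invr_ge0 mulr_ge0// ltW.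
have h1 : E radial_div <= (a * b)^-1 * (17 / 2).
  have := @expect_radial_div_sqr_le 1 0 1; rewrite mmeasure1 pmean1 mulr1 => /(_ isT ltr01).
  under [X in E X]funext do rewrite meval1 expr1n mulr1.
  move=> h; apply: le_trans h _; apply: ler_wpM2l => //; rewrite invr1 !mul1r mulr0 !add0r; lra.
have h2 : E (fun x => radial_div x * meval x p ^+ 2) <= (a * b)^-1 *
    ((s * ((d%:R + 5) / 2) + s^-1 * ((d%:R + 6) / 2 * (4 * d%:R + 2))) * N).
  apply: le_trans (expect_radial_div_sqr_le hp s0) _; rewrite -mulrA.
  apply: ler_wpM2l => //; apply: ler_wpM2l => //.
  have si : 0 < s^-1 by rewrite invr_gt0.
  by rewrite addr_ge0// !mulr_ge0 ?addr_ge0 ?mulr_ge0// ltW.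
have p0 x : 0 <= radial_div x by exact: radial_div_ge0.
apply: le_trans (weight_norm_le normalZ tame_radial_div t0 p0 h1 h2) _.
by rewrite le_eqVlt; apply/orP; left; apply/eqP; ring.
Qed.

(** The defect is at most [eta^2 / (Y^2 + eta^2)], which is [eta / a] times the derivative of
    [atan (Y / eta)]. *)
Lemma expect_defect_le : E (fun x => eta ^+ 2 / sqradius v u a b c e eta x) <= 5 * eta / a.
Proof.
pose Y := affine a c v.
have dY := dirder_atan (dirderM (dirder_Y_v a c v1) (dirder_cst v eta^-1)).
have W x : `|atan (Y x * eta^-1)| <= 2 by exact: norm_atan_le2.
have := bounded_weight_sqr_le (p := 1) (d := 0) normalZ v1 dY W.
rewrite mmeasure1 pmean1 mulr1 add0r => /(_ isT).
under [X in E X]funext do rewrite meval1 expr1n mulr1 mulr0 addr0.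
have tw : tame (fun x => (1 + (Y x * eta^-1) ^+ 2)^-1 * (a * eta^-1)).
  have := (dirder_tame dY).2.
  by under [X in tame X]funext do rewrite mulr0 addr0.
have k0 : 0 < eta / a by rewrite divr_gt0.
move=> h; apply: (@le_trans _ _ (E (fun x => eta / a *
    ((1 + (Y x * eta^-1) ^+ 2)^-1 * (a * eta^-1))))).
  apply: (expect_le normalZ).
  - by apply: tameZ; exact: tame_sqradius_inv.
  - exact: tameZ.
  move=> x; have r0 := width_gt0 v a c eta0 x.
  have -> : eta / a * ((1 + (Y x * eta^-1) ^+ 2)^-1 * (a * eta^-1))
     = eta ^+ 2 / width v a c eta x.
    have -> : 1 + (Y x * eta^-1) ^+ 2 = width v a c eta x / eta ^+ 2.
      by rewrite /width -/Y; field; rewrite gt_eqF.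
    by rewrite invf_div; field; rewrite !gt_eqF.
  rewrite ler_pM2l ?eta2_gt0// lef_pV2 ?posrE ?width_le_sqradius//.
  exact: sqradius_gt0.
rewrite (expectZ normalZ)//.
have -> : 5 * eta / a = eta / a * (2 * (5 / 2)) by field; rewrite gt_eqF.
by apply: ler_wpM2l h; exact: ltW.
Qed.

End plane_bounds.
End bounds.

(** * The main estimate *)
Section constants.
Context {R : realType}.

(** The three lemmas of this section bound the values that the estimates of the previous part
    take for [h] of degree [k] with mean square at most [N^2] and Young's parameter
    [t = k * N]: for the derivative of [h] (degree [k - 1]), for [h] times a linear form
    (degree [k + 1]), and for the divergence term. *)
Lemma gradient_constant (k N : R) : 2 <= k -> 0 < N ->
  2^-1 * (k * N * (5 / 2) + (k * N)^-1 * ((k - 1 + 5) / 2 * (k * N ^+ 2))) <= 2 * (k * N).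
Proof.
move=> k2 N0; have k0 : 0 < k by exact: lt_le_trans k2.
have -> : (k * N)^-1 * ((k - 1 + 5) / 2 * (k * N ^+ 2)) = (k + 4) / 2 * N.
  by field; rewrite !gt_eqF.
have kN0 : 0 < k * N by rewrite mulr_gt0.
have kN : 2 * N <= k * N by rewrite ler_pM2r.
by clear k2 N0 k0; lra.
Qed.

Lemma multiplier_constant (k N : R) : 2 <= k -> 0 < N ->
  2^-1 * (k * N * (5 / 2) + (k * N)^-1 * ((k + 1 + 5) / 2 * ((4 * k + 2) * N ^+ 2)))
    <= 13 / 2 * (k * N).
Proof.
move=> k2 N0; have k0 : 0 < k by exact: lt_le_trans k2.
have -> : (k * N)^-1 * ((k + 1 + 5) / 2 * ((4 * k + 2) * N ^+ 2))
    = (2 * k + 13) * N + 6 * (k^-1 * N) by field; rewrite !gt_eqF.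
have kN0 : 0 < k * N by rewrite mulr_gt0.
have kN : 2 * N <= k * N by rewrite ler_pM2r.
have iN : k^-1 * N <= 2^-1 * N by rewrite ler_pM2r// lef_pV2 ?posrE.
by clear k2 N0 k0; lra.
Qed.

Lemma divergence_constant (k N : R) : 2 <= k -> 0 < N ->
  2^-1 * (k * N * (17 / 2) + (k * N)^-1 *
    ((k * ((k + 5) / 2) + k^-1 * ((k + 6) / 2 * (4 * k + 2))) * N ^+ 2)) <= 8 * (k * N).
Proof.
move=> k2 N0; have k0 : 0 < k by exact: lt_le_trans k2.
have -> : (k * N)^-1 * ((k * ((k + 5) / 2) + k^-1 * ((k + 6) / 2 * (4 * k + 2))) * N ^+ 2)
    = (k + 9) / 2 * N + 13 * (k^-1 * N) + 6 * (k^-1 * (k^-1 * N)).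
  by field; rewrite !gt_eqF.
have kN0 : 0 < k * N by rewrite mulr_gt0.
have kN : 2 * N <= k * N by rewrite ler_pM2r.
have iN : k^-1 * N <= 2^-1 * N by rewrite ler_pM2r// lef_pV2 ?posrE.
have iiN : k^-1 * (k^-1 * N) <= 2^-1 * (k^-1 * N).
  by rewrite ler_pM2r ?mulr_gt0 ?invr_gt0// lef_pV2 ?posrE.
by clear k2 N0 k0; lra.
Qed.

End constants.

Section core.
Context {disp : measure_display} {T : measurableType disp} {R : realType}.
Variables (P : probability T R) (n : nat) (Z : 'I_n -> {RV P >-> R}).
Hypothesis normalZ : standard_normal_vector P Z.
Local Notation E := (expect Z).
Local Notation mean := (pmean Z).

Variables (v u : 'I_n -> R) (a b c e : R).
Hypotheses (v1 : \sum_i v i * v i = 1) (u1 : \sum_i u i * u i = 1).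
Hypothesis vu : \sum_i v i * u i = 0.
Hypotheses (a0 : 0 < a) (b0 : 0 < b).
Variables (f g : mpoly n R) (F phi : R -> R).
Hypothesis dF : forall t : R, is_derive t 1 F (phi t).
Hypothesis phi1 : forall t, `|phi t| <= 1.
Hypothesis cphi : continuous phi.
Hypothesis Dvg : forall x, meval x (mder v g) = 2 * a * affine a c v x.
Hypothesis Dug : forall x, meval x (mder u g) = 2 * b * affine b e u x.

Let h : mpoly n R := f - g.
Let K x := F (meval x f) - F (meval x g).
Let jump x := phi (meval x f) - phi (meval x g).

Lemma uv : \sum_i u i * v i = 0.
Proof. by rewrite -[RHS]vu; apply: eq_bigr => i _; exact: mulrC. Qed.

Lemma dirder_K w : dirder w K (fun x =>
  phi (meval x f) * meval x (mder w f) - phi (meval x g) * meval x (mder w g)).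
Proof. by apply: dirderB; apply: dirder_antiderivative => //; exact: dirder_meval. Qed.

Lemma K_le x : `|K x| <= `|meval x h|.
Proof. by rewrite /h mevalB; exact: (lipschitz_antiderivative dF phi1). Qed.

Lemma tame_phi (p : mpoly n R) : tame (fun x => phi (meval x p)).
Proof.
apply: (tame_comp (f := phi)); first exact: continuous_measurable_fun.
  exact: tame_meval.
by apply: (@bounded_poly_growth _ _ _ 1) => x /=.
Qed.

Section regularized.
Variable eta : R.
Hypothesis eta0 : 0 < eta.
Let V := radial_field v u a b c e eta.
Let V' := radial_field u v b a e c eta.
Let Q := sqradius v u a b c e eta.
Let defect x := eta ^+ 2 / Q x.
Let rho := radial_div v u a b c e eta.

Lemma sqradius_sym x : sqradius u v b a e c eta x = Q x.
Proof. by rewrite /Q /sqradius [_ + affine a c v x ^+ 2]addrC. Qed.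

Let remainder x := - (K x * rho x) + defect x * jump x
  - phi (meval x f) * (V x * meval x (mder v h) + V' x * meval x (mder u h)).

Lemma tame_remainder : tame remainder.
Proof.
have tK : tame K by exact: (dirder_tame (dirder_K v)).1.
have tV : tame V by exact: (dirder_tame (dirder_radial_field b c e v1 vu a0 eta0)).1.
have tV' : tame V' by exact: (dirder_tame (dirder_radial_field a e c u1 uv b0 eta0)).1.
have tr : tame rho by exact: tame_radial_div.
have td : tame defect by apply: tameZ; exact: tame_sqradius_inv.
have tj : tame jump by apply: tameB; exact: tame_phi.
apply: tameB.
  by apply: tameD; [apply: tameN; exact: tameM|exact: tameM].
apply: tameM; first exact: tame_phi.
by apply: tameD; apply: tameM => //; exact: tame_meval.
Qed.

(** The pointwise identity behind this is
    [jump = V * D_v K + V' * D_u K + defect * jump - phi (f) * (V * D_v h + V' * D_u h)],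
    where the first two terms are completed to derivatives of products. *)
Lemma expect_jump : E jump = E (fun x => linear_form v x * (K x * V x))
  + E (fun x => linear_form u x * (K x * V' x)) + E remainder.
Proof.
have d1 := dirderM (dirder_K v) (dirder_radial_field b c e v1 vu a0 eta0).
have d2 := dirderM (dirder_K u) (dirder_radial_field a e c u1 uv b0 eta0).
rewrite -(stein normalZ d1) -(stein normalZ d2).
have [_ t1] := dirder_tame d1; have [_ t2] := dirder_tame d2.
have t3 := tame_remainder.
rewrite -!(expectD normalZ)//; last exact: tameD.
congr E; apply/funext => x.
rewrite /remainder /jump !Dvg !Dug -/K -/V -/V' sqradius_sym -/Q.
have Q0 : 0 < Q x by exact: sqradius_gt0.
have -> : meval x (mder v f) = meval x (mder v h) + 2 * a * affine a c v x.
  by rewrite /h mderB mevalB Dvg subrK.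
have -> : meval x (mder u f) = meval x (mder u h) + 2 * b * affine b e u x.
  by rewrite /h mderB mevalB Dug subrK.
rewrite /V /V' /rho /defect /radial_div /radial_field sqradius_sym -/(sqradius v u a b c e eta) -/Q.
have eE : eta ^+ 2 = Q x - affine a c v x ^+ 2 - affine b e u x ^+ 2.
  by rewrite /Q /sqradius; ring.
rewrite eE; field; by rewrite !gt_eqF.
Qed.

Lemma expect_jump_le (m : nat) (N : R) : (mmeasure mdeg h <= m.+3)%N -> 0 < N ->
  mean (h * h) <= N ^+ 2 ->
  E jump <= 40 * m.+2%:R / (a * b) * N + 10 * eta / a.
Proof.
move=> hm N0 hN.
have tK : tame K by exact: (dirder_tame (dirder_K v)).1.
have tV : tame V by exact: (dirder_tame (dirder_radial_field b c e v1 vu a0 eta0)).1.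
have tV' : tame V' by exact: (dirder_tame (dirder_radial_field a e c u1 uv b0 eta0)).1.
have tr : tame rho by exact: tame_radial_div.
have td : tame defect by apply: tameZ; exact: tame_sqradius_inv.
have tl w := tame_linear_form w.
have tp (p : mpoly n R) : tame (fun x => `|meval x p|) by apply: tame_norm; exact: tame_meval.
have tnV := tame_norm tV; have tnV' := tame_norm tV'.
set k : R := m.+2%:R.
have k2 : 2 <= k by rewrite /k (ler_nat _ 2).
have k0 : 0 < k by lra.
(* Young's parameter; it has the order of the norms that it has to balance *)
pose t := k * N; have t0 : 0 < t by rewrite mulr_gt0.
set B := (a * b)^-1.
have B0 : 0 < B by rewrite invr_gt0 mulr_gt0.
have T2 w : \sum_l w l * w l = 1 -> mean ((mlin w * h) * (mlin w * h)) <= (4 * k + 2) * N ^+ 2.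
  move=> w1; apply: le_trans (pmean_mlin_sqr_le normalZ w1 hm) _.
  by apply: ler_wpM2l hN; lra.
have T1 w : \sum_l w l * w l = 1 -> mean (mder w h * mder w h) <= k * N ^+ 2.
  move=> w1; apply: le_trans (pmean_mder_sqr_le normalZ w1 hm) _.
  by apply: ler_wpM2l hN; lra.
have A1 := expect_radial_field_norm_le normalZ c e v1 u1 vu a0 b0 eta0
  (mder_msize v hm) t0 (T1 v v1).
have A2 := expect_radial_field_norm_le normalZ e c u1 v1 uv b0 a0 eta0
  (mder_msize u hm) t0 (T1 u u1).
have A3 := expect_radial_field_norm_le normalZ c e v1 u1 vu a0 b0 eta0
  (mlinM_msize v hm) t0 (T2 v v1).
have A4 := expect_radial_field_norm_le normalZ e c u1 v1 uv b0 a0 eta0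
  (mlinM_msize u hm) t0 (T2 u u1).
have A5 := expect_radial_div_norm_le normalZ c e v1 u1 vu a0 b0 eta0 hm k0 t0 hN.
have A6 := expect_defect_le normalZ b c e v1 vu a0 eta0.
rewrite [b * a]mulrC in A2 A4.
have kS : m.+3%:R = k + 1 by rewrite /k -natr1.
have kP : m.+1%:R = k - 1 by rewrite /k -[m.+2%:R]natr1 addrK.
rewrite -/V -/V' -/B -/k -/rho -/Q ?kS ?kP in A1 A2 A3 A4 A5 A6.
have b1 := gradient_constant k2 N0; have b3 := multiplier_constant k2 N0.
have b5 := divergence_constant k2 N0.
have {}A1 := le_trans A1 (ler_wpM2l (ltW B0) b1).
have {}A2 := le_trans A2 (ler_wpM2l (ltW B0) b1).
have {}A3 := le_trans A3 (ler_wpM2l (ltW B0) b3).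
have {}A4 := le_trans A4 (ler_wpM2l (ltW B0) b3).
have {}A5 := le_trans A5 (ler_wpM2l (ltW B0) b5).
have C1 w (G : ('I_n -> R) -> R) : tame G ->
    E (fun x => linear_form w x * (K x * G x)) <= E (fun x => `|G x| * `|meval x (mlin w * h)|).
  move=> tG; apply: (expect_le normalZ).
  - by apply: tameM; [exact: tl|exact: tameM].
  - by apply: tameM; [exact: tame_norm|exact: tp].
  move=> x; apply: le_trans (ler_norm _) _.
  rewrite mevalM meval_lin !normrM mulrA [leRHS]mulrC; apply: ler_wpM2r => //.
  by apply: ler_wpM2l => //; exact: K_le.
have C2 : E remainder <= E (fun x => rho x * `|meval x h|) + 2 * E defect
    + E (fun x => `|V x| * `|meval x (mder v h)|) + E (fun x => `|V' x| * `|meval x (mder u h)|).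
  have t1 : tame (fun x => rho x * `|meval x h|) by exact: tameM.
  have t2 : tame (fun x => 2 * defect x) by exact: tameZ.
  have t3 w : tame (fun x => `|V x| * `|meval x (mder w h)|) by exact: tameM.
  have t4 w : tame (fun x => `|V' x| * `|meval x (mder w h)|) by exact: tameM.
  have t12 := tameD t1 t2; have t123 := tameD t12 (t3 v).
  rewrite -(expectZ normalZ)// -(expectD normalZ t1 t2).
  rewrite -(expectD normalZ t12 (t3 v)) -(expectD normalZ t123 (t4 u)).
  apply: (expect_le normalZ); [exact: tame_remainder|exact: tameD|].
  move=> x; rewrite /remainder.
  have r0 : 0 <= rho x by exact: radial_div_ge0.
  have d0 : 0 <= defect x by rewrite divr_ge0 ?sqr_ge0// ltW// sqradius_gt0.
  have e1 : - (K x * rho x) <= rho x * `|meval x h|.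
    apply: le_trans (ler_norm _) _; rewrite normrN normrM (ger0_norm r0) mulrC.
    by apply: ler_wpM2l => //; exact: K_le.
  have e2 : defect x * jump x <= 2 * defect x.
    rewrite mulrC; apply: ler_wpM2r => //.
    apply: le_trans (ler_norm _) _; apply: le_trans (ler_normB _ _) _.
    exact: (lerD (phi1 _) (phi1 _)).
  have e3 (p q : R) : - (phi (meval x f) * (p + q)) <= `|p| + `|q|.
    apply: le_trans (ler_norm _) _; rewrite normrN normrM.
    apply: le_trans (ler_wpM2r (normr_ge0 _) (phi1 _)) _.
    by rewrite mul1r; exact: ler_normD.
  rewrite -[leRHS]addrA; apply: lerD; first exact: lerD.
  by rewrite -!normrM; exact: e3.
have D1 := C1 v V tV; have D2 := C1 u V' tV'.
rewrite expect_jump; apply: le_trans (lerD (lerD (le_trans D1 A3) (le_trans D2 A4)) C2) _.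
have -> : 40 * k * B * N + 10 * eta / a = B * (40 * (k * N)) + 2 * (5 * eta / a).
  by field; rewrite gt_eqF.
have BkN : 0 <= B * (k * N) by rewrite !mulr_ge0// ltW.
have {}A6 : 2 * E defect <= 2 * (5 * eta / a) by rewrite ler_pM2l.
apply: le_trans (lerD (lexx _) (lerD (lerD (lerD A5 A6) A1) A2)) _.
move: (k * N) (5 * eta / a) BkN => s q s0.
have -> : B * (13 / 2 * s) + B * (13 / 2 * s) + (B * (8 * s) + 2 * q + B * (2 * s) + B * (2 * s))
  = 25 * (B * s) + 2 * q by field.
have -> : B * (40 * s) = 40 * (B * s) by ring.
by rewrite lerD2r ler_wpM2r// ler_nat.
Qed.
End regularized.

(** The regularization has done its work: [eta] tends to 0. *)
Theorem expect_test_le (m : nat) (N : R) : (mmeasure mdeg h <= m.+3)%N ->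
  0 < N -> mean (h * h) <= N ^+ 2 ->
  E (fun x => phi (meval x f)) - E (fun x => phi (meval x g))
    <= 40 * m.+2%:R / (a * b) * N.
Proof.
move=> hm N0 hN; rewrite -(expectB normalZ); [|exact: tame_phi|exact: tame_phi].
apply/ler_addgt0Pr => eps eps0.
(* the choice makes the error term [10 * eta / a] equal to [eps] *)
have eta0 : 0 < eps * a / 10 by rewrite divr_gt0// mulr_gt0.
apply: le_trans (expect_jump_le eta0 hm N0 hN) _; rewrite lerD2l.
by rewrite le_eqVlt; apply/orP; left; apply/eqP; field; rewrite gt_eqF.
Qed.

End core.

(** * Test functions, total variation and the mean-square norm *)
Section test_functions.
Context {R : realType}.
Local Notation mu := (@lebesgue_measure R).

Lemma test_function_continuous (phi : R -> R) :
  smooth_compactly_supported phi -> continuous phi.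
Proof.
move=> [dphi _] t; apply: differentiable_continuous; apply/derivable1_diffP.
exact: (dphi 0%N t).
Qed.

Lemma test_function_supnorm (phi : R -> R) : (supnorm phi <= 1)%E ->
  forall t, `|phi t| <= 1.
Proof.
move=> h t; rewrite -lee_fin; apply: le_trans h; apply: ereal_sup_ubound.
by exists t.
Qed.

Lemma test_function_antiderivative (phi : R -> R) : smooth_compactly_supported phi ->
  exists F : R -> R, forall t : R, is_derive t 1 F (phi t).
Proof.
move=> sphi; have cphi := test_function_continuous sphi.
have [_ /compact_bounded[M [Mreal HM]]] := sphi.
have iphi : mu.-integrable setT (EFin \o phi).
  pose A := `[- (`|M| + 1), `|M| + 1]%classic : set R.
  have -> : EFin \o phi = (EFin \o phi) \_ A.
    apply/funext => t; rewrite patchE; case: ifPn => // tA.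
    apply/eqP; rewrite eqe; apply: contraNT tA => pt.
    rewrite inE /A /= in_itv /= -ler_norml; apply: HM.
      by apply: le_lt_trans (ler_norm M) _; rewrite ltrDl.
    exact: subset_closure.
  rewrite -integrable_mkcond; last exact: measurable_itv.
  apply: continuous_compact_integrable; first exact: segment_compact.
  exact: continuous_subspaceT.
exists (fun x => \int[mu]_(t in [set` Interval -oo%O (BRight x)]) phi t)%R; move=> t.
have [] := @continuous_FTC1 R phi -oo%O t (t + 1).
- by rewrite ltrDl.
- exact: integrableS iphi.
- by rewrite ltNyr.
- exact: cphi.
move=> d1 d2; exact: (DeriveDef d1 (etrans (esym (derive1E _ _)) d2)).
Qed.

End test_functions.

Section total_variation.
Context {disp : measure_display} {T : measurableType disp} {R : realType}.
Variables (P : probability T R) (n : nat) (Z : 'I_n -> {RV P >-> R}).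
Hypothesis normalZ : standard_normal_vector P Z.

Lemma L2norm_mean (p : mpoly n R) (xi : T -> R) :
  (forall w, xi w = meval (fun i => Z i w) p) ->
  L2norm P xi = (Num.sqrt (pmean Z (p * p)))%:E.
Proof.
move=> xiE; rewrite /L2norm unlock /=.
have -> : (\int[P]_x `|(EFin \o xi) x| `^ 2 = (pmean Z (p * p))%:E)%E.
  rewrite /pmean -(expect_EFin normalZ (tame_meval _)); apply: eq_integral => w _.
  by rewrite /= xiE powR_mulrn// mevalM -expr2 -normrX ger0_norm// sqr_ge0.
by rewrite poweR_EFin powR12_sqrt// pmean_sqr_ge0.
Qed.

Lemma dTV_le (p q : mpoly n R) (xi zeta : T -> R) (M : R) :
  (forall w, xi w = meval (fun i => Z i w) p) ->
  (forall w, zeta w = meval (fun i => Z i w) q) ->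
  (forall phi F : R -> R, continuous phi -> (forall t, `|phi t| <= 1) ->
    (forall t : R, is_derive t 1 F (phi t)) ->
    expect Z (fun x => phi (meval x p)) - expect Z (fun x => phi (meval x q)) <= M) ->
  (dTV P xi zeta <= M%:E)%E.
Proof.
move=> xiE zetaE H; apply: ge_ereal_sup => _ [phi [sphi phi1] <-].
have cphi := test_function_continuous sphi.
have b1 := test_function_supnorm phi1.
have [F dF] := test_function_antiderivative sphi.
have tphi (r : mpoly n R) : tame (fun x => phi (meval x r)) by exact: tame_phi.
have EE (z : T -> R) (r : mpoly n R) : (forall w, z w = meval (fun i => Z i w) r) ->
    ('E_P[phi \o z] = (expect Z (fun x => phi (meval x r)))%:E)%E.
  move=> zE; rewrite unlock -(expect_EFin normalZ (tphi _)); apply: eq_integral => w _.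
  by rewrite /= zE.
by rewrite (EE _ _ xiE) (EE _ _ zetaE) -EFinB lee_fin; exact: (H _ F).
Qed.

(** The strict upper bound [N] is replaced by the mean-square norm itself, which may be 0. *)
Lemma expect_test_sqrt_le (f g : mpoly n R) (phi F : R -> R) (m : nat) (v u : 'I_n -> R)
    (a b c e : R) :
  continuous phi -> (forall t, `|phi t| <= 1) ->
  (forall t : R, is_derive t 1 F (phi t)) ->
  \sum_i v i * v i = 1 -> \sum_i u i * u i = 1 -> \sum_i v i * u i = 0 ->
  0 < a -> 0 < b ->
  (forall x, meval x (mder v g) = 2 * a * affine a c v x) ->
  (forall x, meval x (mder u g) = 2 * b * affine b e u x) ->
  (mmeasure mdeg (f - g) <= m.+3)%N ->
  expect Z (fun x => phi (meval x f)) - expect Z (fun x => phi (meval x g)) <=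
    40 * m.+2%:R / (a * b) * Num.sqrt (pmean Z ((f - g) * (f - g))).
Proof.
move=> cphi phi1 dF v1 u1 vu a0 b0 Dv Du hm.
set D := 40 * m.+2%:R / (a * b).
have D0 : 0 < D by rewrite divr_gt0 ?mulr_gt0.
apply/ler_addgt0Pr => eps eps0.
set s := Num.sqrt _; have s0 : 0 <= s by exact: sqrtr_ge0.
(* [N] is the norm plus [eps / D], so that the excess is exactly [eps] *)
have e0 : 0 < eps / D by rewrite divr_gt0.
have -> : D * s + eps = D * (s + eps / D) by field; rewrite gt_eqF.
apply: (expect_test_le normalZ v1 u1 vu a0 b0 dF phi1 cphi Dv Du hm).
  by rewrite ltr_wpDl.
rewrite -[leLHS]sqr_sqrtr ?pmean_sqr_ge0// -/s.
by rewrite lerXn2r ?nnegrE ?addr_ge0 ?lerDl// ltW.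
Qed.

(** Negative eigenvalues reduce to positive ones by passing to [- f], [- g] and the reflected
    test function. *)
Lemma expect_test_opp_le (f g : mpoly n R) (phi F : R -> R) (m : nat) (v u : 'I_n -> R)
    (a b c e : R) :
  continuous phi -> (forall t, `|phi t| <= 1) ->
  (forall t : R, is_derive t 1 F (phi t)) ->
  \sum_i v i * v i = 1 -> \sum_i u i * u i = 1 -> \sum_i v i * u i = 0 ->
  0 < a -> 0 < b ->
  (forall x, meval x (mder v g) = - (2 * a * affine a c v x)) ->
  (forall x, meval x (mder u g) = - (2 * b * affine b e u x)) ->
  (mmeasure mdeg (f - g) <= m.+3)%N ->
  expect Z (fun x => phi (meval x f)) - expect Z (fun x => phi (meval x g)) <=
    40 * m.+2%:R / (a * b) * Num.sqrt (pmean Z ((f - g) * (f - g))).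
Proof.
move=> cphi phi1 dF v1 u1 vu a0 b0 Dv Du hm.
have mderN w (p : mpoly n R) : mder w (- p) = - mder w p.
  by rewrite -scaleN1r mderZ scaleN1r.
have hE : - f - - g = - (f - g) by ring.
have cN : continuous (fun t => phi (- t)).
  move=> t; apply: (@continuous_comp _ _ _ -%R phi); last exact: cphi.
  exact: opp_continuous.
have dN (t : R) : is_derive t 1 (fun t => - F (- t)) (phi (- t)).
  have d1 := dF (- t).
  have d2 : is_derive t 1 -%R (- 1 : R) by apply: is_deriveN.
  have d3 := is_derive1_comp (f := F) (g := -%R) d1 d2.
  by apply: is_derive_eq; rewrite /GRing.scale /=; ring.
have := @expect_test_sqrt_le (- f) (- g) (fun t => phi (- t)) (fun t => - F (- t)) m v u a b c e
  cN (fun t => phi1 (- t)) dN v1 u1 vu a0 b0.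
rewrite hE mulrNN mmeasureN.
have EN' (p : mpoly n R) :
    (fun x => phi (- meval x (- p))) = (fun x : 'I_n -> R => phi (meval x p)).
  by apply/funext => x; rewrite mevalN opprK.
rewrite !EN'; apply => //.
- by move=> x; rewrite mderN mevalN Dv opprK.
- by move=> x; rewrite mderN mevalN Du opprK.
Qed.

End total_variation.

(** * Orthonormal eigenvectors *)
Section eigenvectors.
Context {R : realType} {n : nat}.
Implicit Types (B : 'M[R]_n) (v u : 'I_n -> R).

Definition eigvec B (s : R) v : Prop := forall i, \sum_j B i j * v j = s * v i.

Lemma self_adjoint_sym B : self_adjoint B -> forall i j, B i j = B j i.
Proof.
move=> saB i j; have := saB (delta_mx i 0) (delta_mx j 0); rewrite /dotp.
have D (C : 'cV[R]_n) k : \sum_l C l 0 * (delta_mx k 0 : 'cV[R]_n) l 0 = C k 0.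
  rewrite (bigD1 k)//= mxE !eqxx mulr1 big1 ?addr0// => l lk.
  by rewrite mxE (negbTE lk) mulr0.
rewrite D; under eq_bigr do rewrite mulrC; rewrite D.
by rewrite -!colE !mxE => ->.
Qed.

Lemma eigvec_orthogonal B s1 s2 v u : self_adjoint B -> s1 != s2 ->
  eigvec B s1 v -> eigvec B s2 u -> \sum_i v i * u i = 0.
Proof.
move=> /self_adjoint_sym symB s12 ev eu.
have h : s1 * (\sum_i v i * u i) = s2 * (\sum_i v i * u i).
  rewrite !mulr_sumr.
  under eq_bigr do rewrite mulrA -ev mulr_suml.
  rewrite exchange_big /=; apply: eq_bigr => i _.
  rewrite mulrCA -eu mulr_sumr; apply: eq_bigr => j _.
  by rewrite symB; ring.
apply/eqP; have /eqP : (s1 - s2) * (\sum_i v i * u i) = 0 by rewrite mulrBl h subrr.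
by rewrite mulf_eq0 subr_eq0 (negbTE s12).
Qed.

Lemma eigenspace_eigvec B s (w : 'rV[R]_n) : (w <= eigenspace B^T s)%MS ->
  eigvec B s (fun i => w 0 i).
Proof.
move=> /eigenspaceP h i; have := congr1 (fun C : 'rV_n => C 0 i) h.
rewrite !mxE => <-; apply: eq_bigr => j _; by rewrite mxE mulrC.
Qed.

Lemma normalize v : (exists i, v i != 0) -> exists2 c : R, c != 0 &
  \sum_i (c * v i) * (c * v i) = 1.
Proof.
move=> [i vi]; set N := \sum_i v i * v i.
have N0 : 0 < N.
  rewrite /N (bigD1 i)//= ltr_pwDl// ?sumr_ge0// => [|j _]; last first.
    by rewrite -expr2 sqr_ge0.
  by rewrite lt_def mulf_neq0// -expr2 sqr_ge0.
exists (Num.sqrt N)^-1; first by rewrite invr_eq0 gt_eqF// sqrtr_gt0.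
under eq_bigr do rewrite mulrACA.
by rewrite -mulr_sumr -/N -expr2 exprVn sqr_sqrtr ?ltW// mulVf// gt_eqF.
Qed.

Lemma eigvecZ B s v c : eigvec B s v -> eigvec B s (fun i => c * v i).
Proof.
move=> ev i; rewrite mulrCA -ev mulr_sumr; apply: eq_bigr => j _.
by rewrite mulrCA.
Qed.

Lemma unit_eigvec B s (w : 'rV[R]_n) : (w <= eigenspace B^T s)%MS -> w != 0 ->
  exists2 c : R, c != 0 & eigvec B s (fun i => c * w 0 i) /\
  \sum_i (c * w 0 i) * (c * w 0 i) = 1.
Proof.
move=> wE w0; have [|c c0 hc] := @normalize (fun i => w 0 i).
  by have /rV0Pn := w0.
by exists c => //; split => //; apply: eigvecZ; exact: eigenspace_eigvec.
Qed.

Lemma count_eigvals B s : (count_mem s (eigvals B) <= eigmult B s)%N.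
Proof.
rewrite /eigvals; have := uniq_roots (- cauchy_bound (char_poly B))
  (cauchy_bound (char_poly B)) (char_poly B); rewrite -/(rootsR _).
elim: (rootsR _) => //= r rs IH /andP[rrs urs].
rewrite count_cat count_nseq /=; have [rs'|rs'] := eqVneq r s; last first.
  by rewrite mul0n add0n IH.
rewrite mul1n -rs' (_ : count_mem r _ = 0%N) ?addn0//; apply/count_memPn.
apply: contra rrs => /flattenP[_ /mapP[q qrs ->]].
by rewrite mem_nseq => /andP[_ /eqP ->].
Qed.

Lemma eigvals_unit_eigvec B s : s \in eigvals B ->
  exists v, eigvec B s v /\ \sum_i v i * v i = 1.
Proof.
rewrite -has_pred1 has_count => /leq_trans/(_ (count_eigvals B s)).
rewrite /eigmult lt0n mxrank_eq0 => /rowV0Pn[w wE w0].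
by have [c _ [ev v1]] := unit_eigvec wE w0; exists (fun i => c * w 0 i).
Qed.

(** The second vector lies in the kernel of the inner product with the first one, restricted
    to the eigenspace; this kernel is nonzero since the eigenspace has rank at least 2. *)
Lemma eigvals_double B s : (2 <= count_mem s (eigvals B))%N ->
  exists v u, [/\ eigvec B s v, eigvec B s u, \sum_i v i * v i = 1,
    \sum_i u i * u i = 1 & \sum_i v i * u i = 0].
Proof.
move=> h2; have := leq_trans h2 (count_eigvals B s); rewrite /eigmult.
set M := eigenspace _ _ => rk.
have /rowV0Pn[w wM w0] : M != 0 by rewrite -mxrank_eq0 -lt0n (ltn_trans _ rk).
have [c c0 [ev v1]] := unit_eigvec wM w0.
set A := row_base M; set C := A *m w^T.
have kC : kermx C != 0.
  rewrite -mxrank_eq0 mxrank_ker subn_eq0 -ltnNge.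
  exact: leq_ltn_trans (rank_leq_col _) _.
have /rowV0Pn[x xC x0] := kC.
set z := x *m A.
have zM : (z <= M)%MS by rewrite -(eq_row_base M) submxMl.
have z0 : z != 0.
  apply: contra x0 => /eqP z0; apply/eqP.
  by apply: (row_free_inj (row_base_free M)); rewrite mul0mx.
have zw : \sum_i w 0 i * z 0 i = 0.
  have : z *m w^T = 0 by rewrite -mulmxA; exact/sub_kermxP.
  move=> /(congr1 (fun D : 'M[R]_1 => D 0 0)); rewrite mxE [in RHS]mxE => h.
  by apply: etrans h; apply: eq_bigr => i _; rewrite [w^T _ _]mxE mulrC.
have [k k0 [eu u1]] := unit_eigvec zM z0.
exists (fun i => c * w 0 i), (fun i => k * z 0 i); split => //.
by under eq_bigr do rewrite mulrACA; rewrite -mulr_sumr zw mulr0.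
Qed.

(** The values at two distinct positions of a list, in a form invariant under
    permutation. *)
Definition two_entries (s1 s2 : R) (l : seq R) : Prop :=
  [/\ s1 \in l, s2 \in l & (s1 = s2 -> (2 <= count_mem s1 l)%N)].

Lemma nth_two_entries (l : seq R) (i j : nat) : (i < size l)%N -> (j < size l)%N ->
  i != j -> two_entries (nth 0 l i) (nth 0 l j) l.
Proof.
move=> il jl ij; split; [exact: mem_nth|exact: mem_nth|].
wlog lij : i j il jl ij / (i < j)%N.
  move=> H; case: (ltngtP i j) ij => // [ij _|ji _]; first by apply: H => //; rewrite neq_ltn ij.
  by move=> e; rewrite e; apply: (H j i) => //; rewrite neq_ltn ji.
move=> e.
have h1 : nth 0 l i \in take j l by rewrite -(nth_take 0 lij) mem_nth// size_take jl.
have h2 : nth 0 l i \in drop j l.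
  have -> : nth 0 l i = nth 0 (drop j l) 0 by rewrite nth_drop addn0.
  by rewrite mem_nth// size_drop subn_gt0.
set s := nth 0 l i in h1 h2 *; rewrite -(cat_take_drop j l) count_cat.
by apply: (@leq_add 1 1); rewrite -has_count has_pred1.
Qed.

Lemma two_entries_perm s1 s2 l l' : perm_eq l l' -> two_entries s1 s2 l -> two_entries s1 s2 l'.
Proof.
move=> p [h1 h2 h3]; split; rewrite -?(perm_mem p)// => /h3.
by rewrite (permP p).
Qed.

Lemma eigvals_orthonormal B s1 s2 : self_adjoint B -> two_entries s1 s2 (eigvals B) ->
  exists v u, [/\ eigvec B s1 v, eigvec B s2 u, \sum_i v i * v i = 1,
    \sum_i u i * u i = 1 & \sum_i v i * u i = 0].
Proof.
move=> saB [h1 h2 h3]; have [e|s12] := eqVneq s1 s2.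
  by subst s2; exact/eigvals_double/h3.
have [v [ev v1]] := eigvals_unit_eigvec h1; have [u [eu u1]] := eigvals_unit_eigvec h2.
by exists v, u; split => //; exact: eigvec_orthogonal saB s12 ev eu.
Qed.

End eigenvectors.

(** * The quadratic function as a polynomial *)
Section quadratic.
Context {R : realType} {n : nat}.
Variables (B : 'M[R]_n) (b : 'cV[R]_n) (beta : R).

Definition quadpoly : mpoly n R :=
  \sum_i mlin (fun j => B i j) * mpolyX R (mnm1 i) + mlin (fun j => b j 0) + mpolyC n beta.

Lemma meval_quadpoly x : meval x quadpoly = quadfun B b beta (\col_i x i).
Proof.
rewrite /quadpoly /quadfun !mevalD mevalC raddf_sum/= meval_lin; congr (_ + _ + _).
  apply: eq_bigr => i _; rewrite mevalM meval_lin mevalXU !mxE; congr (_ * _).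
  by apply: eq_bigr => j _; rewrite mxE.
by apply: eq_bigr => i _; rewrite mxE.
Qed.

Lemma quadpoly_msize : (mmeasure mdeg quadpoly <= 3)%N.
Proof.
apply: msizeD_le; last by rewrite mmeasureC; case: (_ != 0).
apply: msizeD_le; last by apply: leq_trans (mlin_msize _) _.
elim: (index_enum _) => [|i r IH]; first by rewrite big_nil mmeasure0.
rewrite big_cons; apply: msizeD_le => //; apply: mlinM_msize.
by rewrite msizeX mdeg1.
Qed.

Lemma meval_mder_quadpoly (s : R) (v x : 'I_n -> R) : self_adjoint B -> eigvec B s v ->
  meval x (mder v quadpoly) = 2 * s * linear_form v x + \sum_i b i 0 * v i.
Proof.
move=> /self_adjoint_sym symB ev.
rewrite /quadpoly !mderD mderC addr0 mder_lin mevalD mevalC; congr (_ + _).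
rewrite mder_sum raddf_sum /=.
under eq_bigr => i _ do rewrite mderM mder_lin mderX1 mevalD !mevalM !mevalC meval_lin mevalXU ev.
rewrite big_split /=.
have h : \sum_i s * v i * x i = s * linear_form v x.
  by rewrite mulr_sumr; apply: eq_bigr => i _; rewrite mulrA.
rewrite h -mulrA mulrDl mul1r; congr (_ + _).
rewrite -h /linear_form; under eq_bigr do rewrite mulr_suml.
rewrite exchange_big /=; apply: eq_bigr => j _.
rewrite -ev mulr_suml; apply: eq_bigr => i _.
by rewrite symB; ring.
Qed.

End quadratic.

(** * The bound for two eigenvalues of the same sign and the conclusion *)
Section same_sign_bound.
Context {disp : measure_display} {T : measurableType disp} {R : realType}.
Variables (P : probability T R) (n : nat) (Z : 'I_n -> {RV P >-> R}).
Hypothesis normalZ : standard_normal_vector P Z.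
Variables (B : 'M[R]_n) (b : 'cV[R]_n) (beta : R) (f : mpoly n R) (d : nat).
Hypothesis saB : self_adjoint B.
Hypothesis fd : (mmeasure mdeg f <= d.+1)%N.
Let fZ := fun w : T => meval (fun i => Z i w) f.
Let gZ := fun w : T => quadfun B b beta (\col_i Z i w).

(** In an eigendirection the derivative of [g] is [2 s x_v + b_v]; with [a = sqrt |s|] it is
    [+-2 a (a x_v + c)] for a suitable [c], as the main estimate requires. *)
Lemma dTV_same_sign_le (s1 s2 : R) : two_entries s1 s2 (eigvals B) -> same_sign s1 s2 ->
  (dTV P fZ gZ <= (40 * (maxn d 2)%:R / Num.sqrt (`|s1| * `|s2|))%:E
     * L2norm P (fun w => (fZ w - gZ w)%R))%E.
Proof.
move=> s12 sgn; have [v [u [ev eu v1 u1 vu]]] := eigvals_orthonormal saB s12.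
pose g := quadpoly B b beta.
have gE w : gZ w = meval (fun i => Z i w) g by rewrite meval_quadpoly.
rewrite (L2norm_mean normalZ (p := f - g)); last by move=> w; rewrite mevalB -gE.
rewrite -EFinM; apply: (dTV_le normalZ (p := f) (q := g)) => // phi F cphi phi1 dF.
have [m mE] : exists m, maxn d 2 = m.+2.
  by have := leq_maxr d 2; case: (maxn d 2) => [|[|m]] // _; exists m.
have hm : (mmeasure mdeg (f - g) <= m.+3)%N.
  apply: msizeD_le; first by apply: leq_trans fd _; rewrite ltnS -mE leq_maxl.
  by rewrite mmeasureN; apply: leq_trans (quadpoly_msize _ _ _) _.
have Dv x := meval_mder_quadpoly b beta x saB ev.
have Du x := meval_mder_quadpoly b beta x saB eu.
rewrite mE sqrtrM//.
have aff (s a t : R) (w : 'I_n -> R) (x : 'I_n -> R) : a != 0 -> a ^+ 2 = s ->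
    2 * s * linear_form w x + t = 2 * a * affine a (t / (2 * a)) w x.
  by move=> an <-; rewrite /affine; field.
have aff' (s a t : R) (w : 'I_n -> R) (x : 'I_n -> R) : a != 0 -> a ^+ 2 = - s ->
    2 * s * linear_form w x + t = - (2 * a * affine a (- t / (2 * a)) w x).
  by move=> an /eqP; rewrite eq_sym eqr_oppLR => /eqP ->; rewrite /affine; field.
case: sgn => -[h1 h2].
- have a0 : 0 < Num.sqrt `|s1| by rewrite sqrtr_gt0 normr_gt0 gt_eqF.
  have b0 : 0 < Num.sqrt `|s2| by rewrite sqrtr_gt0 normr_gt0 gt_eqF.
  apply: (expect_test_sqrt_le normalZ cphi phi1 dF v1 u1 vu a0 b0 _ _ hm) => x.
    by rewrite Dv; apply: aff; rewrite ?gt_eqF// sqr_sqrtr// gtr0_norm.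
  by rewrite Du; apply: aff; rewrite ?gt_eqF// sqr_sqrtr// gtr0_norm.
- have a0 : 0 < Num.sqrt `|s1| by rewrite sqrtr_gt0 normr_gt0 lt_eqF.
  have b0 : 0 < Num.sqrt `|s2| by rewrite sqrtr_gt0 normr_gt0 lt_eqF.
  apply: (expect_test_opp_le normalZ cphi phi1 dF v1 u1 vu a0 b0 _ _ hm) => x.
    by rewrite Dv; apply: aff'; rewrite ?gt_eqF// sqr_sqrtr// ltr0_norm.
  by rewrite Du; apply: aff'; rewrite ?gt_eqF// sqr_sqrtr// ltr0_norm.
Qed.

End same_sign_bound.

Lemma sorted_abs_nth {R : realType} (lam : seq R) (i j : nat) :
  sorted (fun x y : R => `|y| <= `|x|) lam -> (i <= j)%N -> (j < size lam)%N ->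
  `|nth 0 lam j| <= `|nth 0 lam i|.
Proof.
move=> srt ij jl.
have trans : transitive (fun x y : R => `|y| <= `|x|).
  by move=> y1 y2 y3 h1 h2; exact: le_trans h2 h1.
have refl : reflexive (fun x y : R => `|y| <= `|x|) by move=> y; exact: lexx.
apply: (sorted_leq_nth trans refl 0 srt) => //; rewrite inE.
exact: leq_ltn_trans ij jl.
Qed.

Lemma sorted_abs_third_neq0 {R : realType} (lam : seq R) :
  sorted (fun x y : R => `|y| <= `|x|) lam ->
  (3 <= count (fun l : R => l != 0%R) lam)%N -> nth 0 lam 2 != 0.
Proof.
move=> srt cnt; apply: contraTneq cnt => l20; rewrite -ltnNge ltnS.
rewrite -(cat_take_drop 2 lam) count_cat.
have -> : count (fun l : R => l != 0) (drop 2 lam) = 0%N.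
  apply/eqP; rewrite -leqn0 leqNgt -has_count; apply/hasPn => y /(nthP 0)[k].
  rewrite size_drop nth_drop ltn_subRL => kl <-; rewrite negbK -normr_le0.
  by have := sorted_abs_nth srt (leq_addr k 2) kl; rewrite l20 normr0.
rewrite addn0; apply: leq_trans (count_size _ _) _.
by rewrite size_take; case: ifP => // /negbT; rewrite -leqNgt.
Qed.

Lemma same_sign_pigeonhole {R : realType} (x y z : R) : x != 0 -> y != 0 -> z != 0 ->
  [\/ same_sign x y, same_sign x z | same_sign y z].
Proof.
rewrite /same_sign.
case: (ltgtP x 0) => // hx _; case: (ltgtP y 0) => // hy _;
  case: (ltgtP z 0) => // hz _.
- by apply: Or31; right.
- by apply: Or31; right.
- by apply: Or32; right.
- by apply: Or33; left.
- by apply: Or33; right.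
- by apply: Or32; left.
- by apply: Or31; left.
- by apply: Or31; left.
Qed.

Theorem corollary3p1 (R : realType) :
  exists C : nat -> R, C 2%N = 80 /\
  forall (d n : nat) (disp : measure_display) (T : measurableType disp)
    (P : probability T R) (Z : 'I_n -> {RV P >-> R})
    (B : 'M[R]_n) (b : 'cV[R]_n) (beta : R) (f : mpoly n R),
  standard_normal_vector P Z ->
  self_adjoint B ->
  (3 <= count (fun l : R => l != 0%R) (eigvals B))%N ->
  (mmeasure mdeg f <= d.+1)%N ->
  let fZ := fun w : T => meval (fun i => Z i w) f in
  let gZ := fun w : T => quadfun B b beta (\col_i Z i w) in
  (forall i j : nat, (i < size (eigvals B))%N -> (j < size (eigvals B))%N ->
     i != j ->
     let s1 := nth 0 (eigvals B) i in
     let s2 := nth 0 (eigvals B) j in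
     same_sign s1 s2 ->
     (dTV P fZ gZ <= (C d / Num.sqrt (`|s1| * `|s2|))%:E
                     * L2norm P (fun w => (fZ w - gZ w)%R))%E) /\
  (forall lam : seq R, perm_eq lam (eigvals B) ->
     sorted (fun x y : R => `|y| <= `|x|) lam ->
     (dTV P fZ gZ <= (C d / Num.sqrt (`|nth 0 lam 1| * `|nth 0 lam 2|))%:E
                     * L2norm P (fun w => (fZ w - gZ w)%R))%E).
Proof.
exists (fun d => 40 * (maxn d 2)%:R); split; first by rewrite -natrM.
move=> d n disp T P Z B b beta f normalZ saB cnt fd fZ gZ; split.
  move=> i j il jl ij s1 s2 sgn.
  exact: (dTV_same_sign_le normalZ b beta saB fd (nth_two_entries il jl ij) sgn).
move=> lam plam srt.
have cl : (3 <= count (fun l : R => l != 0%R) lam)%N by rewrite (permP plam).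
have sz : (2 < size lam)%N by apply: leq_trans cl (count_size _ _).
have l2 := sorted_abs_third_neq0 srt cl.
have ord i j : (i <= j)%N -> (j < 3)%N -> `|nth 0 lam j| <= `|nth 0 lam i|.
  by move=> ij j3; apply: sorted_abs_nth => //; exact: leq_trans j3 sz.
have p2 : 0 < `|nth 0 lam 2| by rewrite normr_gt0.
have p1 : 0 < `|nth 0 lam 1| by apply: lt_le_trans (ord 1%N 2%N _ _).
have p0 : 0 < `|nth 0 lam 0| by apply: lt_le_trans (ord 0%N 2%N _ _).
have key i j : (i < j)%N -> (j < 3)%N -> same_sign (nth 0 lam i) (nth 0 lam j) ->
    (dTV P fZ gZ <= (40 * (maxn d 2)%:R /
        Num.sqrt (`|nth 0 lam 1| * `|nth 0 lam 2|))%:E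
      * L2norm P (fun w => (fZ w - gZ w)%R))%E.
  move=> ij j3 sgn; have jl := leq_trans j3 sz; have il := ltn_trans ij jl.
  have nij : i != j by rewrite neq_ltn ij.
  have te := two_entries_perm plam (nth_two_entries il jl nij).
  apply: le_trans (dTV_same_sign_le normalZ b beta saB fd te sgn) _.
  apply: lee_wpmul2r; first exact: Lnorm_ge0.
  rewrite lee_fin; apply: ler_wpM2l; first by rewrite mulr_ge0.
  have q1 : 0 < `|nth 0 lam 1| * `|nth 0 lam 2| by rewrite mulr_gt0.
  have q2 : `|nth 0 lam 1| * `|nth 0 lam 2| <= `|nth 0 lam i| * `|nth 0 lam j|.
    apply: ler_pM => //; apply: ord => //.
    exact: leq_trans ij j3.
  rewrite lef_pV2 ?posrE ?sqrtr_gt0//; first exact: ler_wsqrtr.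
  exact: lt_le_trans q2.
have := same_sign_pigeonhole (_ : nth 0 lam 0 != 0) (_ : nth 0 lam 1 != 0) l2.
rewrite -!normr_gt0 => /(_ p0 p1)[]; exact: key.
Qed.
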